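(* Let $a,b$ be positive integers with $a\le b$ and let $f^{a,b}_1(x,y,z,w)=ax^2+by^2+(z^2+zw+w^2)$ for $x,y,z,w\in\mathbb{Z}$. (1) $f^{a,b}_1$ represents every nonnegative integer if and only if $(a,b)=(1,b)$ with $b\in\{1,2,3,4,5,6\}$ or $(a,b)=(2,b)$ with $b\in\{2,3,4,5,6,7,8,9,10\}$. (2) If $f^{a,b}_1$ represents $n=1,2,6,10$, then it represents every nonnegative integer.
   Context: A form represents $n$ if $n$ equals the form evaluated at some integer arguments. *)

(* Defs.v *)
From Stdlib Require Import ZArith.
Open Scope Z_scope.

Definition f1 (a b x y z w : Z) : Z :=
  a * x ^ 2 + b * y ^ 2 + (z ^ 2 + z * w + w ^ 2).

Definition represents (a b n : Z) : Prop :=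
  exists x y z w : Z, f1 a b x y z w = n.

Definition universal (a b : Z) : Prop :=
  forall n : Z, 0 <= n -> represents a b n.

(* Main.v *)
Require Import Defs.
From Stdlib Require Import ZArith.
From mathcomp Require Import all_boot all_order all_algebra.
From mathcomp Require Import all_fingroup all_solvable all_field.
From mathcomp Require Import realalg boolp zify.
From mathcomp Require ring lra.
Open Scope Z_scope.

(** Write [N(z, w) = z^2 + z w + w^2].  Since [N] misses 2, [x^2 + N] misses 6
and [2 x^2 + N] misses 10, representing 2, 6 and 10 leaves fifteen pairs.

Conversely, [x^2 + N] represents every [n > 0] prime to 3, and [2 x^2 + N]
represents [n] as soon as [6 n] is a sum of three squares, which is shown for
[n] odd and for [n = 6 mod 8]; a suitable choice of [y], or a descent through
the factors 3 and 4, then treats all fifteen forms.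

A ternary form representing [n] is glued from a number [A] such that [-A] is a
square modulo a multiple of [n] and [-n] (or [-3 n]) is a square modulo [A];
its discriminant is so small that reduction identifies it.  Instead of taking
[A] prime, which needs Dirichlet's theorem, it suffices that [A] be a product
of primes [p] with [chi p = 1], where [chi] is the quadratic character of [-n]
(or [-3 n]).  The classes of these products, up to squares, fill the kernel
of [chi]: otherwise a real character [psi], distinct from 1 and [chi], would
be 1 at every prime where [chi] is 1.  The convolution of [psi chi] and [psi]
would then be nonnegative, and at least 1 at the squares prime to the modulus,
so that its sum weighted by [1 / sqrt n] would dominate a harmonic sum, whereas
the hyperbola method bounds that sum. *)

Set Implicit Arguments.
Unset Strict Implicit.
Unset Printing Implicit Defensive.

Section QuadraticCharacters.

Import Order.TTheory GRing.Theory Num.Theory ring lra.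
Local Open Scope ring_scope.

(** * Real characters and the hyperbola method *)

(** A real Dirichlet character modulo [M], principal or imprimitive ones included; the last clause
    fixes at once the support and the values 1 and -1. *)
Definition real_char (M : nat) (f : nat -> int) : Prop :=
  [/\ forall m n, f (m * n)%N = f m * f n,
      forall m, f (m + M)%N = f m &
      forall m, f m ^+ 2 = (coprime m M)%:R].

Section RealChar.

Variables (M : nat) (f : nat -> int).
Hypotheses (M_gt0 : (0 < M)%N) (fP : real_char M f).

Lemma real_charM m n : f (m * n)%N = f m * f n.
Proof. by case: fP. Qed.

Lemma real_char_sqr m : f m ^+ 2 = (coprime m M)%:R.
Proof. by case: fP. Qed.

Lemma real_char1 : f 1 = 1.
Proof.
have := real_charM 1 1; rewrite muln1 -expr2 real_char_sqr coprime1n => ->.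
by [].
Qed.

Lemma real_charX m k : f (m ^ k)%N = f m ^+ k.
Proof.
elim: k => [|k IHk]; first by rewrite expn0 real_char1 expr0.
by rewrite expnS real_charM IHk exprS.
Qed.

Lemma real_char_mod m : f (m %% M)%N = f m.
Proof.
rewrite {2}(divn_eq m M) addnC; elim: (m %/ M)%N => [|k IHk].
  by rewrite mul0n addn0.
by rewrite mulSnr addnA; case: fP => _ -> _.
Qed.

Lemma real_char_eqmod m n : m = n %[mod M] -> f m = f n.
Proof. by rewrite -real_char_mod => ->; rewrite real_char_mod. Qed.

Lemma real_char_values m : [\/ f m = 1, f m = -1 | f m = 0].
Proof.
have := real_char_sqr m; case: coprime => /eqP.
  by rewrite sqrf_eq1 => /orP[]/eqP ->; [constructor 1|constructor 2].
by rewrite sqrf_eq0 => /eqP->; constructor 3.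
Qed.

Lemma real_char_coprime m : coprime m M -> f m = 1 \/ f m = -1.
Proof.
move=> cmM; have := real_char_sqr m; rewrite cmM => /eqP.
by rewrite sqrf_eq1 => /orP[]/eqP ->; [left|right].
Qed.

Lemma real_char_ncoprime m : ~~ coprime m M -> f m = 0.
Proof.
move=> cmM; have := real_char_sqr m; rewrite (negPf cmM) => /eqP.
by rewrite sqrf_eq0 => /eqP.
Qed.

Lemma real_char_norm m : `|f m| <= 1.
Proof. by case: (real_char_values m) => ->. Qed.

Variable t : nat.
Hypothesis ft : f t = -1.

(** Multiplication by [t] permutes the residues modulo [M] and changes the sign of the sum. *)
Lemma real_char_sum_period : \sum_(i < M) f i = 0.
Proof.
have ctM : coprime t M.
  by apply: contraT => /real_char_ncoprime; rewrite ft.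
pose h (i : 'I_M) : 'I_M := Ordinal (ltn_pmod (t * i) M_gt0).
have hI : injective h.
  move=> i j /(congr1 val) /= /eqP.
  wlog le_ij : i j / (i <= j)%N => [hw|].
    by case/orP: (leq_total i j) => l; [apply: hw|rewrite eq_sym => /(hw _ _ l)].
  rewrite eq_sym eqn_mod_dvd ?leq_mul2l ?le_ij ?orbT // -mulnBr.
  rewrite Gauss_dvdr 1?coprime_sym // => dv; apply: val_inj => /=.
  have := ltn_ord j; case: (posnP (j - i)%N) => [|pos lt_j]; first by lia.
  by have := dvdn_leq pos dv; lia.
have : \sum_(i < M) f i = - \sum_(i < M) f i.
  rewrite {1}(reindex_inj hI) /= -mulN1r -ft mulr_sumr; apply: eq_bigr => i _.
  by rewrite real_char_mod real_charM.
by lia.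
Qed.

(** The sums [F n] are periodic modulo [M] and move by at most 1 at each step, so two of them differ
    by at most [M]. *)
Lemma real_char_partial_sum a b : `|\sum_(a <= i < b) f i| <= M%:Z.
Proof.
pose F n := \sum_(0 <= i < n) f i.
have FM n : F (n + M)%N = F n.
  elim: n => [|n IHn]; first by rewrite /F big_nil add0n big_mkord real_char_sum_period.
  by rewrite addSn /F !big_nat_recr //= -!/(F _) IHn; case: fP => _ ->.
have Fmod n : F n = F (n %% M)%N.
  rewrite {1}(divn_eq n M) addnC; elim: (n %/ M)%N => [|k IHk].
    by rewrite mul0n addn0.
  by rewrite mulSnr addnA FM.
have Fd m n : (m <= n)%N -> `|F n - F m| <= (n - m)%N%:Z.
  move=> le_mn; rewrite /F (@big_cat_nat _ _ _ m) //=.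
  rewrite addrAC subrr add0r; apply: le_trans (ler_norm_sum _ _ _) _.
  rewrite -[leRHS]mulr1 -natz mulr_natl -sumr_const_nat.
  by apply: ler_sum => i _; exact: real_char_norm.
case: (leqP a b) => [le_ab|/ltnW le_ba]; last by rewrite big_geq.
have -> : \sum_(a <= i < b) f i = F b - F a.
  by rewrite /F (@big_cat_nat _ _ _ a 0 b) //= addrAC subrr add0r.
rewrite (Fmod b) (Fmod a).
have := ltn_pmod a M_gt0; have := ltn_pmod b M_gt0.
case: (leqP (a %% M) (b %% M)) => [/Fd|/ltnW /Fd]; last rewrite distrC.
  by lia.
by lia.
Qed.

End RealChar.

(** * Divisor sums of real characters *)

Lemma prime_power_ind (P : nat -> Prop) :
    P 1%N ->
    (forall p k m, prime p -> (0 < m)%N -> coprime p m -> P m -> P (p ^ k * m)%N) ->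
  forall n, (0 < n)%N -> P n.
Proof.
move=> P1 PM n; have [N] := ubnP n; elim: N n => // N IHN n lt_nN n_gt0.
have [n1|n1] := leqP n 1; first by have -> : n = 1%N by lia.
have p_pr := pdiv_prime n1; have [m cpm Dn] := pfactor_coprime p_pr n_gt0.
have m_gt0 : (0 < m)%N by move: n_gt0; rewrite Dn muln_gt0 => /andP[].
rewrite Dn mulnC; apply: PM => //; apply: IHN => //.
apply: (@leq_trans n); last by [].
rewrite Dn -[X in (X < _)%N]muln1 ltn_pmul2l //.
rewrite -[1%N](expn0 (pdiv n)) ltn_exp2l ?prime_gt1 //.
by rewrite logn_gt0 mem_primes p_pr n_gt0 pdiv_dvd.
Qed.

Lemma perm_divisors_prime_powerM p k m : prime p -> (0 < m)%N -> coprime p m ->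
  perm_eq (divisors (p ^ k * m))
          [seq (p ^ i * d)%N | i <- iota 0 k.+1, d <- divisors m].
Proof.
move=> p_pr m_gt0 cpm; have p_gt0 := prime_gt0 p_pr.
have cp d : (d %| m)%N -> coprime p d by move=> dm; apply: coprime_dvdr dm cpm.
apply: uniq_perm; first exact: divisors_uniq.
  apply: allpairs_uniq; rewrite ?iota_uniq ?divisors_uniq // => -[i d] [j e].
  case/allpairsPdep=> [i1 [d1 [_ d1m [-> ->]]]] /allpairsPdep[j1 [e1 [_ e1m [-> ->]]]] /= eq.
  move: d1m e1m; rewrite -!dvdn_divisors // => d1m e1m.
  have d1_gt0 := dvdn_gt0 m_gt0 d1m; have e1_gt0 := dvdn_gt0 m_gt0 e1m.
  have L x y : (0 < y)%N -> coprime p y -> logn p (p ^ x * y) = x.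
    by move=> y0 cy; rewrite lognM ?expn_gt0 ?p_gt0 // pfactorK // logn_coprime // addn0.
  have ij : i1 = j1 by rewrite -(L i1 d1) ?cp // eq L ?cp.
  move: eq; rewrite ij => /eqP; rewrite eqn_pmul2l ?expn_gt0 ?p_gt0 //.
  by move=> /eqP->.
move=> d; rewrite -dvdn_divisors ?muln_gt0 ?expn_gt0 ?p_gt0 //.
apply/idP/allpairsPdep => [dv|[i [e [ik em ->]]]]; last first.
  move: ik em; rewrite mem_iota -dvdn_divisors // => ik em.
  by apply: dvdn_mul => //; apply: dvdn_exp2l; lia.
have d_gt0 : (0 < d)%N by apply: dvdn_gt0 dv; rewrite muln_gt0 expn_gt0 p_gt0.
have [e cpe De] := pfactor_coprime p_pr d_gt0.
exists (logn p d), e; split; last by rewrite mulnC.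
  have := dvdn_leq_log p _ dv; rewrite muln_gt0 expn_gt0 p_gt0 m_gt0 => /(_ isT).
  rewrite lognM ?expn_gt0 ?p_gt0 // pfactorK // (logn_coprime cpm) addn0 mem_iota.
  by lia.
rewrite -dvdn_divisors // -(Gauss_dvdr m (_ : coprime e (p ^ k))).
  by apply: dvdn_trans dv; rewrite De dvdn_mulr.
by rewrite coprimeXr // coprime_sym.
Qed.

Definition divisor_sum (f : nat -> int) n := \sum_(d <- divisors n) f d.

Lemma divisor_sum_prime_powerM M f p k m : real_char M f ->
    prime p -> (0 < m)%N -> coprime p m ->
  divisor_sum f (p ^ k * m) = (\sum_(i < k.+1) f p ^+ i) * divisor_sum f m.
Proof.
move=> fP p_pr m_gt0 cpm; rewrite /divisor_sum.
rewrite (perm_big _ (perm_divisors_prime_powerM k p_pr m_gt0 cpm)).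
rewrite big_allpairs_dep mulr_suml.
rewrite -[iota 0 k.+1]/(index_iota 0 k.+1) big_mkord; apply: eq_bigr => i _.
rewrite mulr_sumr; apply: eq_bigr => d _.
by rewrite (real_charM fP) (real_charX fP).
Qed.

Section Twisted.

Variables (M : nat) (chi psi : nat -> int).
Hypotheses (chiP : real_char M chi) (psiP : real_char M psi).
Hypothesis chi_psi :
  forall p, prime p -> coprime p M -> chi p = 1 -> psi p = 1.

Let T n := psi n * divisor_sum chi n.

(** The local factor of [T] at [p]. If [chi p = 1] then [psi p = 1] and it is [k + 1]; if
    [chi p = -1] the geometric sum is 1 for even [k] and 0 for odd [k]; if [p] divides [M] only
    [k = 0] contributes. *)
Lemma geometric_real_char p k : prime p ->
  0 <= psi (p ^ k)%N * (\sum_(i < k.+1) chi p ^+ i) /\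
  (coprime p M -> ~~ odd k -> 1 <= psi (p ^ k)%N * (\sum_(i < k.+1) chi p ^+ i)).
Proof.
move=> p_pr; rewrite (real_charX psiP).
have [cpM|cpM] := boolP (coprime p M); last first.
  rewrite (real_char_ncoprime psiP cpM) (real_char_ncoprime chiP cpM).
  split=> //; case: k => [|k]; last by rewrite expr0n mul0r.
  by rewrite big_ord_recl big_ord0.
have Dk := odd_double_half k.
have evenX (x : int) : x ^+ 2 = 1 -> x ^+ k = x ^+ odd k.
  by move=> x2; rewrite -{1}Dk -mul2n exprD exprM x2 expr1n mulr1.
have p2 : psi p ^+ 2 = 1 by rewrite (real_char_sqr psiP) cpM.
case: (real_char_coprime chiP cpM) => chip.
  rewrite chip chi_psi // expr1n mul1r.
  rewrite (eq_bigr (fun=> 1)) => [|i _]; last by rewrite expr1n.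
  by rewrite sumr_const card_ord; split; lia.
have -> : \sum_(i < k.+1) chi p ^+ i = (~~ odd k)%:R.
  rewrite chip; elim: (k) => [|j IHj]; first by rewrite big_ord_recl big_ord0.
  by rewrite big_ord_recr /= IHj -signr_odd /=; case: odd.
rewrite evenX //; case: odd => /=; last by rewrite mulr1 expr0.
by rewrite mulr0.
Qed.

Lemma twisted_divisor_sum_ge0 n : (0 < n)%N -> 0 <= T n.
Proof.
move: n; apply: prime_power_ind => [|p k m p_pr m_gt0 cpm IHm].
  by rewrite /T /divisor_sum big_seq1 (real_char1 chiP) (real_char1 psiP).
rewrite /T (real_charM psiP) (divisor_sum_prime_powerM k chiP) // mulrACA.
by apply: mulr_ge0 IHm; case: (geometric_real_char k p_pr).
Qed.

Lemma twisted_divisor_sum_sqr_ge1 n :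
  (0 < n)%N -> coprime n M -> 1 <= T (n ^ 2)%N.
Proof.
move: n; apply: prime_power_ind => [_|p k m p_pr m_gt0 cpm IHm].
  by rewrite /T /divisor_sum big_seq1 (real_char1 chiP) (real_char1 psiP).
rewrite coprimeMl => /andP[cpkM cmM].
rewrite expnMn -expnM /T (real_charM psiP) (divisor_sum_prime_powerM _ chiP) //; last 2 first.
- by rewrite expn_gt0 m_gt0.
- by rewrite coprimeXr.
rewrite mulrACA -[1]mulr1; apply: ler_pM => //; last exact: IHm.
case: k cpkM => [|k] cpkM.
  by rewrite mul0n expn0 big_ord_recl big_ord0 (real_char1 psiP).
case: (geometric_real_char (k.+1 * 2) p_pr) => _; apply.
  by move: cpkM; rewrite coprime_pexpl.
by rewrite oddM andbF.
Qed.

End Twisted.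

(** * Summation by parts, the hyperbola method and harmonic sums *)

Section SumLemmas.

Variable R : rcfType.

(** Summation by parts. Monotonicity is asked from [a] on because the weight used later, [invsqrt],
    has the default value 0 at 0. *)
Lemma abel_bound (g : nat -> R) (w : nat -> R) (K : R) (a b : nat) :
    (forall c, `|\sum_(a <= i < c) g i| <= K) ->
    (forall i, 0 <= w i) ->
    (forall i, (a <= i)%N -> w i.+1 <= w i) -> (a <= b)%N ->
  `|\sum_(a <= i < b) g i * w i| <= K * w a.
Proof.
move=> gK w_ge0 w_le le_ab.
(* With the boundary term kept apart, the bound telescopes and passes through an induction on
   [b]. *)
suff main : `|\sum_(a <= i < b) g i * w i - (\sum_(a <= i < b) g i) * w b|
         <= K * (w a - w b).
  rewrite -[X in `|X|](subrK ((\sum_(a <= i < b) g i) * w b)).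
  apply: le_trans (ler_normD _ _) _; rewrite normrM (ger0_norm (w_ge0 b)).
  have := ler_wpM2r (w_ge0 b) (gK b); move: main; rewrite mulrBr; lra.
elim: b le_ab => [|b IHb].
  by rewrite leqn0 => /eqP->; rewrite !big_geq // mul0r !subrr normr0 mulr0.
rewrite leq_eqVlt => /predU1P[->|]; first by rewrite !big_geq // mul0r !subrr normr0 mulr0.
rewrite ltnS => le_ab; have := IHb le_ab.
rewrite !(@big_nat_recr _ _ _ b) //=.
set S := \sum_(_ <= i < _) _; set G := \sum_(_ <= i < _) _ => IH.
have -> : S + g b * w b - (G + g b) * w b.+1
        = (S - G * w b) + (G + g b) * (w b - w b.+1) by ring.
apply: le_trans (ler_normD _ _) _; rewrite normrM.
have w0 : 0 <= w b - w b.+1 by rewrite subr_ge0 w_le.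
rewrite (ger0_norm w0).
have /(ler_wpM2r w0) : `|G + g b| <= K by have := gK b.+1; rewrite big_nat_recr.
by move: IH; rewrite !mulrBr; lra.
Qed.

Lemma sum_nat_leq_mul (G : nat -> R) (a d X : nat) : (0 < d)%N ->
  \sum_(a <= e < X.+1 | (d * e <= X)%N) G e = \sum_(a <= e < (X %/ d).+1) G e.
Proof.
move=> d_gt0; rewrite [RHS](big_nat_widen _ _ X.+1) ?ltnS ?leq_div //.
by apply: eq_bigl => e; rewrite ltnS leq_divRL // mulnC.
Qed.

(** A pair with [d * e <= u ^ 2] has [d <= u], or else [d > u] and then [e <= u]. *)
Lemma hyperbola (g h : nat -> R) (u : nat) :
  let X := (u ^ 2)%N in
  \sum_(1 <= d < X.+1) \sum_(1 <= e < X.+1 | (d * e <= X)%N) g d * h e =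
  \sum_(1 <= d < u.+1) g d * (\sum_(1 <= e < (X %/ d).+1) h e) +
  \sum_(1 <= e < u.+1) h e * (\sum_(u.+1 <= d < (X %/ e).+1) g d).
Proof.
move=> X; have uX : (u <= X)%N by rewrite /X; nia.
rewrite (@big_cat_nat _ _ _ u.+1) //=; congr (_ + _).
  apply: eq_big_nat => d /andP[d1 _].
  by rewrite -mulr_sumr sum_nat_leq_mul.
under eq_bigr do rewrite big_mkcond /=.
rewrite exchange_big_nat /= (@big_cat_nat _ _ _ u.+1) //=.
rewrite [X in _ + X]big_nat_cond [X in _ + X]big1 ?addr0.
  apply: eq_big_nat => e /andP[e1 _].
  rewrite -big_mkcond /= -mulr_suml -sum_nat_leq_mul // mulrC.
  by congr (_ * _); apply: eq_bigl => d; rewrite mulnC.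
move=> e /andP[/andP[ue _] _]; rewrite big_nat_cond big1 // => d /andP[/andP[ud _] _].
case: leqP => //; rewrite /X; nia.
Qed.

Lemma sum_divisors (F : nat -> nat -> R) (X : nat) :
  \sum_(1 <= n < X.+1) \sum_(d <- divisors n) F d (n %/ d)%N =
  \sum_(1 <= d < X.+1) \sum_(1 <= e < X.+1 | (d * e <= X)%N) F d e.
Proof.
transitivity (\sum_(1 <= n < X.+1) \sum_(1 <= d < X.+1)
                 if (d %| n)%N then F d (n %/ d)%N else 0).
  apply: eq_big_nat => n /andP[n1 nX].
  rewrite -big_mkcond /= -[RHS]big_filter; apply: perm_big.
  apply: uniq_perm; rewrite ?divisors_uniq ?filter_uniq ?iota_uniq // => d.
  rewrite mem_filter mem_index_iota -dvdn_divisors //.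
  case: (boolP (d %| n)%N) => //= dn.
  by rewrite (dvdn_gt0 n1 dn) ltnS (leq_trans (dvdn_leq n1 dn)).
rewrite exchange_big_nat /=; apply: eq_big_nat => d /andP[d1 dX].
rewrite sum_nat_leq_mul // -big_mkcond /=.
transitivity (\sum_(n <- [seq (d * e)%N | e <- index_iota 1 (X %/ d).+1])
    F d (n %/ d)%N); last by rewrite big_map; apply: eq_bigr => e _; rewrite mulKn.
rewrite -[LHS]big_filter; apply: perm_big; apply: uniq_perm.
- by rewrite filter_uniq ?iota_uniq.
- rewrite map_inj_uniq ?iota_uniq // => x y /eqP.
  by rewrite eqn_pmul2l // => /eqP.
move=> n; rewrite mem_filter mem_index_iota; apply/andP/mapP => [[dn nX]|[e]].
  have Dn := divnK dn.
  exists (n %/ d)%N; last by rewrite mulnC.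
  case/andP: nX => n1 nX.
  by rewrite mem_index_iota divn_gt0 // ltnS leq_divRL // Dn dvdn_leq.
rewrite mem_index_iota ltnS leq_divRL // => /andP[e1 eX] ->.
by rewrite dvdn_mulr // ltnS mulnC eX muln_gt0 e1 d1.
Qed.

(** Each doubling of the range adds [2 ^ i] terms, all at least [1 / 2 ^ (i + 1)]. *)
Lemma harmonic_lower_bound (i : nat) :
  i%:R / 2 <= \sum_(0 <= j < 2 ^ i) (j.+1%:R : R)^-1.
Proof.
elim: i => [|i IHi]; first by rewrite mul0r big_nat1 invr1 ler01.
rewrite (@big_cat_nat _ _ _ (2 ^ i)) ?leq_exp2l //=.
suff : 1 / 2 <= \sum_(2 ^ i <= j < 2 ^ i.+1) (j.+1%:R : R)^-1.
  by move: IHi; rewrite -[i.+1]addn1 natrD mulrDl; lra.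
have -> : 1 / 2 = \sum_(2 ^ i <= j < 2 ^ i.+1) ((2 ^ i.+1)%:R : R)^-1.
  rewrite sumr_const_nat expnS mul2n -addnn addnK -mulr_natr.
  rewrite addnn -mul2n natrM; field.
  by rewrite pnatr_eq0 expn_eq0.
apply: ler_sum_nat => j /andP[_ jlt].
by rewrite lef_pV2 ?posrE ?ltr0n ?expn_gt0 // ler_nat.
Qed.

Lemma ler_sum_subset (s1 s2 : seq nat) (F : nat -> R) :
    uniq s1 -> uniq s2 -> {subset s1 <= s2} ->
    (forall n, n \in s2 -> 0 <= F n) ->
  \sum_(n <- s1) F n <= \sum_(n <- s2) F n.
Proof.
move=> u1 u2 s12 F_ge0; rewrite [leRHS](bigID (mem s1)) /=.
have -> : \sum_(n <- s2 | n \in s1) F n = \sum_(n <- s1) F n.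
  rewrite -big_filter; apply: perm_big; apply: uniq_perm; rewrite ?filter_uniq //.
  by move=> n; rewrite mem_filter andb_idr // => /s12.
rewrite lerDl big_seq_cond sumr_ge0 // => n /andP[/F_ge0].
by [].
Qed.

(** The exponent 1/2 gives the squares the divergent weights [1 / n], yet keeps the error terms of
    the hyperbola method bounded. *)
Definition invsqrt (n : nat) : R := (Num.sqrt n%:R)^-1.

Lemma invsqrt_ge0 n : 0 <= invsqrt n.
Proof. by rewrite invr_ge0 sqrtr_ge0. Qed.

Lemma invsqrtM m n : invsqrt (m * n) = invsqrt m * invsqrt n.
Proof. by rewrite /invsqrt natrM sqrtrM ?ler0n // invfM. Qed.

Lemma invsqrt_sqr n : invsqrt (n ^ 2) = n%:R^-1.
Proof. by rewrite /invsqrt natrX sqrtr_sqr ger0_norm ?ler0n. Qed.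

Lemma ler_invsqrt m n : (0 < m)%N -> (m <= n)%N -> invsqrt n <= invsqrt m.
Proof.
move=> m0 mn; rewrite lef_pV2 ?posrE ?sqrtr_gt0 ?ltr0n ?(leq_trans m0) //.
by rewrite ler_sqrt ?ler0n // ler_nat.
Qed.

Lemma sum_invsqrt u : \sum_(1 <= i < u.+1) invsqrt i <= 2 * Num.sqrt u%:R.
Proof.
elim: u => [|u IHu]; first by rewrite big_geq // sqrtr0 mulr0.
rewrite big_nat_recr //=; apply: le_trans (lerD IHu (lexx _)) _.
rewrite /invsqrt; set x := Num.sqrt u%:R; set y := Num.sqrt u.+1%:R.
have x0 : 0 <= x by rewrite sqrtr_ge0.
have y0 : 0 < y by rewrite sqrtr_gt0 ltr0n.
have x2 : x ^+ 2 = u%:R by rewrite sqr_sqrtr ?ler0n.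
have y2 : y ^+ 2 = u%:R + 1 by rewrite sqr_sqrtr ?ler0n // -addn1 natrD.
rewrite -(ler_pM2r y0) mulrDl mulVf ?gt_eqF //.
(* Since [y ^ 2 - x ^ 2 = 1], the goal [2 x y + 1 <= 2 y ^ 2] is [(y - x) ^ 2 >= 0]. *)
have := sqr_ge0 (y - x); nra.
Qed.

End SumLemmas.

Lemma real_char_mul M f g : real_char M f -> real_char M g ->
  real_char M (fun n => f n * g n).
Proof.
move=> [fM fp f2] [gM gp g2]; split=> [m n|m|m].
- by rewrite fM gM mulrACA.
- by rewrite fp gp.
- by rewrite exprMn f2 g2 -natrM mulnb andbb.
Qed.

Section HyperbolaBound.

Variables (R : rcfType) (M : nat) (f1 f2 : nat -> int) (t1 t2 : nat).
Hypotheses (M_gt0 : (0 < M)%N) (f1P : real_char M f1) (f2P : real_char M f2).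
Hypotheses (f1t : f1 t1 = -1) (f2t : f2 t2 = -1).

Let w := @invsqrt R.
Let g d : R := (f1 d)%:~R * w d.
Let h d : R := (f2 d)%:~R * w d.

Lemma real_char_weighted_sum f t a b : real_char M f -> f t = -1 ->
  (0 < a)%N -> (a <= b)%N -> `|\sum_(a <= i < b) (f i)%:~R * w i| <= M%:R * w a.
Proof.
move=> fP ft a0 ab; apply: abel_bound => // [c|i|i ai].
- rewrite -rmorph_sum /= -intr_norm -[M%:R]/(M%:~R : R) ler_int.
  exact: real_char_partial_sum fP _ ft _ _.
- exact: invsqrt_ge0.
- by apply: ler_invsqrt => //; apply: leq_trans ai.
Qed.

Lemma real_char_weighted_norm f i : real_char M f -> `|(f i)%:~R * w i| <= w i.
Proof.
move=> fP; rewrite normrM (ger0_norm (invsqrt_ge0 _ _)) ler_piMl ?invsqrt_ge0 //.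
by rewrite -intr_norm -[1]/(1%:~R : R) ler_int (real_char_norm fP).
Qed.

(** The bound does not depend on [u]: the part with [d <= u] contributes at most [M ^ 2 + M], the
    part with [d > u] at most [2 M]. *)
Lemma hyperbola_bound (u : nat) : (0 < u)%N ->
  \sum_(1 <= d < (u ^ 2).+1) \sum_(1 <= e < (u ^ 2).+1 | (d * e <= u ^ 2)%N)
     g d * h e <= (M ^ 2 + 3 * M)%N%:R.
Proof.
move=> u0; rewrite hyperbola.
have u0R : 0 < (u%:R : R) by rewrite ltr0n.
have s0 : 0 < Num.sqrt (u%:R : R) by rewrite sqrtr_gt0.
have M0 : 0 <= (M%:R : R) by rewrite ler0n.
have w1 : w 1 = 1 by rewrite /w /invsqrt sqrtr1 invr1.
pose X := (u ^ 2)%N; have uX : (u <= X)%N by rewrite /X; nia.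
(* The sum over [d > u] is at most [M / sqrt u], and the weights of the [e <= u] add up to at most
   [2 sqrt u]. *)
have second : `|\sum_(1 <= e < u.+1) h e * (\sum_(u.+1 <= d < (X %/ e).+1) g d)| <= 2 * M%:R.
  apply: le_trans (ler_norm_sum _ _ _) _.
  apply: (@le_trans _ _ (\sum_(1 <= e < u.+1) w e * (M%:R * w u))).
    apply: ler_sum_nat => e /andP[e1 eu]; rewrite normrM ler_pM //.
      exact: real_char_weighted_norm.
    have le : (u.+1 <= (X %/ e).+1)%N.
      by rewrite ltnS leq_divRL // /X; nia.
    apply: le_trans (real_char_weighted_sum f1P f1t _ le) _ => //.
    by rewrite ler_wpM2l ?ler_invsqrt.
  rewrite -mulr_suml; apply: le_trans (ler_wpM2r _ (sum_invsqrt R u)) _.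
    by rewrite mulr_ge0 ?invsqrt_ge0.
  rewrite mulrA mulrAC -[_ * w u]mulrA mulfV ?gt_eqF // mulr1.
  by rewrite mulrC mulr_natl.
have first : `|\sum_(1 <= d < u.+1) g d * (\sum_(1 <= e < (X %/ d).+1) h e)|
    <= M%:R ^+ 2 + M%:R.
  pose H := \sum_(1 <= e < X.+1) h e.
  have bH : `|H| <= M%:R.
    by apply: le_trans (real_char_weighted_sum f2P f2t _ _) _; rewrite // -/w w1 mulr1.
  (* Completing each inner sum to [H] splits off a product of two bounded sums; only tails
     remain. *)
  have -> : \sum_(1 <= d < u.+1) g d * (\sum_(1 <= e < (X %/ d).+1) h e) =
     H * \sum_(1 <= d < u.+1) g d -
     \sum_(1 <= d < u.+1) g d * (\sum_((X %/ d).+1 <= e < X.+1) h e).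
    rewrite mulr_sumr -sumrB; apply: eq_bigr => d _.
    rewrite /H (@big_cat_nat _ _ _ (X %/ d).+1 1 X.+1) //= ?ltnS ?leq_div //.
    by ring.
  apply: le_trans (ler_normB _ _) _; rewrite normrM expr2; apply: lerD.
    apply: ler_pM => //.
    by apply: le_trans (real_char_weighted_sum f1P f1t _ _) _; rewrite // -/w w1 mulr1.
  apply: le_trans (ler_norm_sum _ _ _) _.
  apply: (@le_trans _ _ (\sum_(1 <= d < u.+1) M%:R / u%:R)); last first.
    rewrite sumr_const_nat subn1 /= -[_ *+ u]mulr_natr divfK //.
    by rewrite gt_eqF.
  apply: ler_sum_nat => d /andP[d1 du]; rewrite normrM.
  have le : ((X %/ d).+1 <= X.+1)%N by rewrite ltnS leq_div.
  apply: le_trans (ler_pM _ _ (real_char_weighted_norm _ f1P)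
                     (real_char_weighted_sum f2P f2t _ le)) _ => //.
  (* As [d * (X %/ d + 1) > X = u ^ 2], the two weights multiply to at most [1 / u], and there are
     [u] values of [d]. *)
  rewrite mulrCA ler_wpM2l // -invsqrtM -invsqrt_sqr ler_invsqrt ?expn_gt0 ?u0 //.
  by rewrite mulnC ltnW // ltn_ceil.
rewrite -/X natrD natrX (_ : (3 * M)%:R = M%:R + 2 * M%:R :> R) ?addrA.
  apply: lerD; [exact: le_trans (ler_norm _) first|exact: le_trans (ler_norm _) second].
by rewrite natrM; ring.
Qed.

End HyperbolaBound.

(* The convolution of [psi chi] and [psi] is [psi(n) * sum_(d | n) chi d]. *)
Theorem real_char_prime_split (M : nat) (chi psi : nat -> int) (t : nat) :
    (1 < M)%N -> real_char M chi -> real_char M psi -> chi t = 1 -> psi t = -1 ->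
  ~ (forall p, prime p -> coprime p M -> chi p = 1 -> psi p = 1).
Proof.
move=> M1 chiP psiP chit psit chi_psi; have M0 := ltnW M1.
pose R : rcfType := realalg.
pose f1 n := psi n * chi n.
have f1P : real_char M f1 by exact: real_char_mul.
have f1t : f1 t = -1 by rewrite /f1 chit psit.
pose T n := psi n * divisor_sum chi n.
(* The lower bound below is [i / (2 M)], so this [i] makes it exceed [M ^ 2 + 3 M] by 1. *)
pose i := (2 * M * (M ^ 2 + 3 * M).+1)%N; pose J := (2 ^ i)%N.
pose u := (J * M)%N.
have u0 : (0 < u)%N by rewrite muln_gt0 expn_gt0.
have := hyperbola_bound R M0 f1P psiP f1t psit u0.
set S := \sum_(1 <= d < _) _.
have DS : S = \sum_(1 <= n < (u ^ 2).+1) (T n)%:~R * invsqrt R n.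
  rewrite /S -(sum_divisors (fun d e => (f1 d)%:~R * invsqrt R d * ((psi e)%:~R * invsqrt R e))).
  apply: eq_big_nat => n /andP[n1 _].
  rewrite /T /divisor_sum mulr_sumr rmorph_sum mulr_suml /=.
  rewrite !big_seq; apply: eq_bigr => d; rewrite -dvdn_divisors // => dn.
  rewrite mulrACA -rmorphM -invsqrtM mulnC divnK //; congr (_%:~R * _).
  by rewrite /f1 mulrAC -(real_charM psiP) mulnC divnK.
have T_ge0 n : (0 < n)%N -> 0 <= (T n)%:~R * invsqrt R n.
  by move=> n0; rewrite mulr_ge0 ?invsqrt_ge0 // ler0z (twisted_divisor_sum_ge0 chiP).
(* Only the terms at [(j M + 1) ^ 2] with [j < J] are kept: these squares are at most [u ^ 2], prime
   to [M], and of weight at least [1 / ((j + 1) M)]. *)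
have Slow : i%:R / 2 / M%:R <= S.
  rewrite DS; apply: (@le_trans _ _
     (\sum_(n <- [seq ((j * M).+1 ^ 2)%N | j <- index_iota 0 J]) (T n)%:~R * invsqrt R n)).
    rewrite big_map; apply: le_trans (ler_wpM2r _ (harmonic_lower_bound R i)) _.
      by rewrite invr_ge0 ler0n.
    rewrite mulr_suml; apply: ler_sum => j _.
    rewrite -invfM invsqrt_sqr -[leLHS]mul1r; apply: ler_pM => //.
    - by rewrite invr_ge0 mulr_ge0 ?ler0n.
    - rewrite -[1]/(1%:~R : R) ler_int (twisted_divisor_sum_sqr_ge1 chiP) //.
      by rewrite /coprime gcdnC -addn1 gcdnMDl gcdn1.
    - rewrite lef_pV2 ?posrE ?mulr_gt0 ?ltr0n // -natrM ler_nat; nia.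
  apply: ler_sum_subset.
  - rewrite map_inj_uniq ?iota_uniq // => x y /eqP.
    by rewrite eqn_exp2r // eqSS eqn_pmul2r // => /eqP.
  - by rewrite iota_uniq.
  - move=> n /mapP[j]; rewrite !mem_index_iota => /= jJ ->.
    by rewrite ltnS leq_exp2r // expn_gt0 /= /u; nia.
  - by move=> n; rewrite mem_index_iota => /andP[n0 _]; exact: T_ge0.
move/(le_trans Slow); rewrite -mulrA -invfM ler_pdivrMr ?mulr_gt0 ?ltr0n //.
rewrite -[2]/(2%:R : R) -!natrM ler_nat /i; nia.
Qed.

(** * Classes modulo squares *)

(** A maximal [H] containing [G] and avoiding [t] has index 2: for [x] outside [H], [t] lies in the
    product of [H] and the powers of [x], and since [x ^ 2] is in [H] this puts [t x] in [H]. *)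
Lemma index2_subgroup_avoiding (gT : finGroupType) (G : {group gT}) (t : gT) :
    (forall x y : gT, commute x y) -> (forall x : gT, (x * x)%g \in G) -> t \notin G ->
  exists H : {group gT}, [/\ G \subset H, t \notin H &
    forall x y, (x * y \in H)%g = ((x \in H) == (y \in H))].
Proof.
move=> comm sqG tG.
have [H /maxgroupP[tH maxH] GH] :=
  @maxgroup_exists _ (fun A : {group gT} => t \notin A) G tG.
exists H; split=> //.
have sqH (x : gT) : (x * x)%g \in H by exact: (subsetP GH).
have tcoset (x : gT) : x \notin H -> (t * x)%g \in H.
  move=> xH.
  have xHnorm : <[x]>%g \subset 'N(H)%g.
    by apply/subsetP => y _; apply/normP/setP => z; rewrite mem_conjg conjgE comm mulgK.
  have Kdef : (H <*> <[x]> = H * <[x]>)%g by rewrite norm_joinEr.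
  have : t \in (H <*> <[x]>)%g.
    apply: contraR xH => tK.
    by rewrite -(maxH _ tK (joing_subl _ _)) (subsetP (joing_subr _ _)) // cycle_id.
  rewrite Kdef => /mulsgP[h y hH /cycleP[k ->] Dt].
  move: tH; rewrite Dt -(odd_double_half k) -mul2n expgD expgM expgS expg1.
  case: (odd k) => /=; last by rewrite expg0 mul1g groupMl // groupX.
  rewrite expg1 -!mulgA (comm ((x * x) ^+ _)%g x) (mulgA x x) => _.
  by apply: groupM => //; apply: groupM => //; apply: groupX.
move=> x y; have [xH|xH] := boolP (x \in H); first by rewrite groupMl.
have [yH|yH] := boolP (y \in H); first by rewrite groupMr // (negPf xH).
have := groupM (tcoset x xH) (tcoset y yH).
by rewrite mulgA -(mulgA t) (comm x t) !mulgA -(mulgA (t * t)%g) groupMl.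
Qed.

(** Total on [nat]: a [k] not prime to [M] gets the default value 1, hence the coprimality
    conditions in what follows. *)
Definition class_mod (M : nat) (k : nat) : {unit 'Z_M} := insubd (1%g : {unit 'Z_M}) (k%:R : 'Z_M).

Section ClassMod.

Variable M : nat.
Hypothesis M_gt1 : (1 < M)%N.

Lemma val_class_mod k : coprime k M -> val (class_mod M k) = k%:R.
Proof. by move=> cp; rewrite /class_mod insubdK // unitZpE // coprime_sym. Qed.

Lemma class_modM k l : coprime k M -> coprime l M ->
  class_mod M (k * l) = (class_mod M k * class_mod M l)%g.
Proof.
move=> ck cl; apply: val_inj.
by rewrite /= !val_class_mod ?coprimeMl ?ck // natrM.
Qed.

Lemma class_mod_eq k l : coprime k M -> coprime l M ->
  class_mod M k = class_mod M l -> k = l %[mod M].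
Proof.
move=> ck cl /(congr1 val); rewrite !val_class_mod // => /(congr1 val) /=.
by rewrite !val_Zp_nat.
Qed.

Lemma class_mod_eqmod k l : k = l %[mod M] -> class_mod M k = class_mod M l.
Proof. by rewrite /class_mod -(Zp_nat_mod M_gt1 k) => ->; rewrite Zp_nat_mod. Qed.

Lemma class_mod_surj (x : {unit 'Z_M}) : exists2 k, coprime k M & x = class_mod M k.
Proof.
have cp : coprime (val x : 'Z_M) M.
  by rewrite coprime_sym -unitZpE // natr_Zp; exact: valP.
exists (val x : 'Z_M) => //; apply: val_inj.
by rewrite val_class_mod // natr_Zp.
Qed.

Lemma class_mod_comm (x y : {unit 'Z_M}) : commute x y.
Proof. by apply: val_inj; rewrite /= mulrC. Qed.

End ClassMod.

(** By contradiction: an index 2 subgroup containing the classes of all [A * s ^ 2] but not that of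
    [t] defines a character [psi] that [real_char_prime_split] excludes. *)
Theorem real_char_kernel_mod_squares (M t : nat) (chi : nat -> int) :
    (1 < M)%N -> real_char M chi -> chi t = 1 ->
  exists A s, [/\ (0 < A)%N, coprime s M, A = t * s ^ 2 %[mod M] &
    forall p, prime p -> (p %| A)%N -> coprime p M /\ chi p = 1].
Proof.
move=> M1 chiP chit; apply: contrapT => nex.
pose good A := (0 < A)%N /\ forall p, prime p -> (p %| A)%N -> coprime p M /\ chi p = 1.
have good_coprime A : good A -> coprime A M.
  move=> [A0 gA]; rewrite coprime_has_primes // ?(ltnW M1) //.
  apply/hasPn => p; rewrite mem_primes => /and3P[p_pr _ pM].
  rewrite mem_primes p_pr A0 /=; apply/negP => /(gA p p_pr)[].
  by rewrite prime_coprime // pM.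
have goodM A B : good A -> good B -> good (A * B)%N.
  move=> [A0 gA] [B0 gB]; split=> [|p p_pr]; first by rewrite muln_gt0 A0.
  by rewrite Euclid_dvdM // => /orP[/(gA p p_pr)|/(gB p p_pr)].
have good1 : good 1%N by split=> // p p_pr; rewrite dvdn1 => /eqP p1; rewrite p1 in p_pr.
pose W := [set x : {unit 'Z_M} | `[< exists A s, [/\ good A, coprime s M &
                                   x = class_mod M (A * s ^ 2)] >]].
have inW A s : good A -> coprime s M -> class_mod M (A * s ^ 2) \in W.
  by move=> gA cs; rewrite inE; apply/asboolP; exists A, s.
have W1 A : good A -> class_mod M A \in W.
  by move=> gA; rewrite -[A in class_mod M A]muln1 -[1%N](exp1n 2) inW // coprime1n.
have gW : group_set W.
  apply/group_setP; split.
    have -> : (1%g : {unit 'Z_M}) = class_mod M 1 by apply: val_inj; rewrite val_class_mod ?coprime1n.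
    exact: W1.
  move=> x y; rewrite inE => /asboolP[A [s [gA cs ->]]]; rewrite inE => /asboolP[B [r [gB cr ->]]].
  have [cA cB] := (good_coprime A gA, good_coprime B gB).
  rewrite -class_modM ?coprimeMl ?coprimeXl ?cA ?cB ?cs ?cr //.
  by rewrite mulnACA -expnMn inW ?coprimeMl ?cs //; exact: goodM.
have ctM : coprime t M.
  by apply: contraT => /(real_char_ncoprime chiP); rewrite chit.
pose GW : {group {unit 'Z_M}} := group gW.
have tW : class_mod M t \notin GW.
  apply/negP; rewrite inE => /asboolP[A [s [gA cs eqt]]]; apply: nex.
  have cAs : coprime (A * s ^ 2) M by rewrite coprimeMl coprimeXl // good_coprime.
  have tAs := class_mod_eq M1 ctM cAs eqt.
  (* The inverse [r] of [s] modulo [M] turns [t = A s ^ 2] into [A = t r ^ 2]. *)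
  have [r cr Dr] : exists2 r, coprime r M & (s * r = 1 %[mod M]).
    have [r cr Dr] := class_mod_surj M1 (class_mod M s)^-1%g.
    exists r => //; apply: (class_mod_eq M1); rewrite ?coprimeMl ?cs ?coprime1n //.
    rewrite class_modM // -Dr mulgV; apply: val_inj; rewrite val_class_mod ?coprime1n //.
  exists A, r; case: gA => A0 gA; split=> //.
  rewrite -modnMml tAs modnMml -mulnA -expnMn -modnMmr -modnXm Dr modnXm exp1n modnMmr.
  by rewrite muln1.
have [x|H [WH tH Hmul]] := index2_subgroup_avoiding (@class_mod_comm M) _ tW.
  have [k ck ->] := class_mod_surj M1 x.
  by rewrite -class_modM // mulnn -[(k ^ 2)%N]mul1n inW.
pose psi k : int := if coprime k M then (-1) ^+ (class_mod M k \notin H) else 0.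
have psiP : real_char M psi.
  split=> [m n|m|m]; rewrite /psi.
  - rewrite coprimeMl; case: (boolP (coprime m M)) => cm /=; last by rewrite mul0r.
    case: (boolP (coprime n M)) => cn /=; last by rewrite mulr0.
    by rewrite class_modM // Hmul; do 2!case: (_ \in H).
  - have -> : coprime (m + M) M = coprime m M.
      by rewrite /coprime -{2}[M]mul1n gcdnC [(1 * M)%N]mul1n addnC -{2}[M]mul1n gcdnMDl gcdnC.
    by rewrite (@class_mod_eqmod _ M1 (m + M) m) // modnDr.
  - by case: coprime => //; case: (_ \in H).
apply: (real_char_prime_split M1 chiP psiP chit).
  by rewrite /psi ctM tH.
move=> p p_pr cpM chip; rewrite /psi cpM (subsetP WH) // W1 //.
split=> [|q q_pr]; first exact: prime_gt0.
by rewrite dvdn_prime2 // => /eqP->.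
Qed.

(** * Quadratic reciprocity *)

Lemma finField_prim_root (F : finFieldType) n : (0 < n)%N -> (n %| #|F|.-1)%N ->
  exists z : F, n.-primitive_root z.
Proof.
move=> n_gt0 dvn; have F1 := finNzRing_gt1 F.
have q_gt0 : (0 < #|F|.-1)%N by rewrite -ltnS prednK // ltnW.
have [||||z _ zP] := hasP (@has_prim_root F #|F|.-1 [seq x <- enum F | x != 0] _ _ _ _) => //.
- apply/allP => x; rewrite mem_filter => /andP[x0 _].
  rewrite unity_rootE -(inj_eq (mulfI x0)) -exprS prednK ?mulr1 ?expf_card //.
  exact: ltnW.
- by rewrite filter_uniq // enum_uniq.
- rewrite -(@leq_add2r 1) addn1 prednK ?(ltnW F1) // cardE -(count_predC (fun x => x != 0) (enum F)).
  rewrite size_filter leq_add2l -(@eq_count _ (pred1 0)); last by move=> x /=; rewrite negbK.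
  by rewrite count_uniq_mem ?enum_uniq // mem_enum.
by exists (z ^+ (#|F|.-1 %/ n)); apply: dvdn_prim_root.
Qed.

(** By Euler's theorem [n] divides [l ^ totient n - 1], the order of the multiplicative group of
    [L]. The Gauss sums below live in such fields. *)
Lemma pchar_field_prim_root l n : prime l -> (0 < n)%N -> coprime l n ->
  exists (L : finFieldType) (z : L), l \in [pchar L] /\ n.-primitive_root z.
Proof.
move=> l_pr n_gt0 cln.
have tn : (0 < totient n)%N by rewrite totient_gt0.
have [L chL cL] := pPrimePowerField l_pr tn.
have [|z zP] := @finField_prim_root L n n_gt0.
  by rewrite cL -subn1 -eqn_mod_dvd ?expn_gt0 ?prime_gt0 // eq_sym; apply/eqP; rewrite Euler_exp_totient.
by exists L, z.
Qed.

(** Allows identities between signs to be checked in a finite field: two such values differ by at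
    most 2 in absolute value. *)
Lemma intr_sign_inj (F : fieldType) (x y : int) : 2%:R != 0 :> F ->
    [\/ x = 1, x = -1 | x = 0] -> [\/ y = 1, y = -1 | y = 0] ->
  x%:~R = y%:~R :> F -> x = y.
Proof.
move=> two_neq0 xP yP /eqP; rewrite -subr_eq0 -rmorphB /= => xy0.
have [//|d] : x = y \/ x - y = 1 \/ x - y = -1 \/ x - y = Posz 2 \/ x - y = - Posz 2.
  by case: xP => xE; case: yP => yE; lia.
exfalso; move: xy0; case: d => [->|[->|[->|->]]].
- by rewrite rmorph1 oner_eq0.
- by rewrite rmorphN1 oppr_eq0 oner_eq0.
- by rewrite -pmulrn (negPf two_neq0).
- by rewrite mulrNz oppr_eq0 -pmulrn (negPf two_neq0).
Qed.

(** Euler's criterion serves as definition; for odd [p], [p./2] is [(p - 1) / 2]. *)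
Definition legendre (p a : nat) : int :=
  let y := (a%:R : 'F_p) ^+ p./2 in if y == 1 then 1 else if y == 0 then 0 else -1.

Section Legendre.

Variable p : nat.
Hypotheses (p_pr : prime p) (p_odd : odd p).

Lemma odd_prime_half : p = p./2.*2.+1.
Proof. by rewrite -{1}(odd_double_half p) p_odd. Qed.

Lemma Fp_natr_eq0 a : ((a%:R : 'F_p) == 0) = (p %| a)%N.
Proof. by rewrite -(dvdn_pcharf (pchar_Fp p_pr)). Qed.

Lemma Fp_two_neq0 : 2%:R != 0 :> 'F_p.
Proof.
rewrite Fp_natr_eq0; apply/negP => /dvdn_leq => /(_ isT).
by rewrite leqNgt odd_prime_gt2.
Qed.

Lemma legendre_values a : [\/ legendre p a = 1, legendre p a = -1 | legendre p a = 0].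
Proof.
by rewrite /legendre; case: ifP => _; [constructor 1|case: ifP => _; [constructor 3|constructor 2]].
Qed.

Lemma Fp_exp_pred (x : 'F_p) : x != 0 -> (x ^+ p./2) ^+ 2 = 1.
Proof.
move=> x0; rewrite -exprM muln2; apply: (mulfI x0).
by rewrite -exprS -odd_prime_half mulr1; have := expf_card x; rewrite card_Fp.
Qed.

Lemma legendreE a : (legendre p a)%:~R = a%:R ^+ p./2 :> 'F_p.
Proof.
rewrite /legendre; case: eqP => [->//|/eqP y1]; case: eqP => [->//|/eqP y0].
have x0 : (a%:R : 'F_p) != 0.
  by apply: contra y0 => /eqP->; rewrite expr0n (eqn0Ngt p./2) half_gt0 prime_gt1.
have /eqP := Fp_exp_pred x0; rewrite sqrf_eq1 (negPf y1) /= => /eqP->.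
by rewrite rmorphN1.
Qed.

Lemma legendreM a b : legendre p (a * b) = legendre p a * legendre p b.
Proof.
apply: (intr_sign_inj Fp_two_neq0); first exact: legendre_values.
  case: (legendre_values a) => ->; rewrite ?mul1r ?mulN1r ?mul0r; last by constructor 3.
    exact: legendre_values.
  by case: (legendre_values b) => ->; rewrite ?opprK ?oppr0; [constructor 2|constructor 1|constructor 3].
by rewrite rmorphM /= !legendreE natrM exprMn.
Qed.

Lemma legendre_mod a b : a = b %[mod p] -> legendre p a = legendre p b.
Proof. by rewrite /legendre -(Fp_nat_mod p_pr a) => ->; rewrite Fp_nat_mod. Qed.

Lemma legendre_sqr a : legendre p a ^+ 2 = (coprime a p)%:R.
Proof.
apply: (@intr_sign_inj 'F_p); first exact: Fp_two_neq0.
- by case: (legendre_values a) => ->; constructor.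
- by case: coprime; constructor.
rewrite rmorphXn /= legendreE coprime_sym prime_coprime // -Fp_natr_eq0.
case: eqP => [->|/eqP x0]; last by rewrite Fp_exp_pred.
by rewrite -exprM expr0n muln2 double_eq0 (eqn0Ngt p./2) half_gt0 prime_gt1.
Qed.

Lemma Fp_prim_root : exists z : 'F_p, (p.-1).-primitive_root z.
Proof.
by apply: finField_prim_root; rewrite ?card_Fp // -ltnS prednK ?prime_gt0 // prime_gt1.
Qed.

(** Writing [a = z ^ i] with [z] a primitive root, [a ^ ((p - 1) / 2) = 1] forces [i] to be even. *)
Lemma legendre1_sqr a : legendre p a = 1 -> exists x, x ^ 2 = a %[mod p].
Proof.
move=> la; have := legendreE a; rewrite la => /esym ah.
have [z zP] := Fp_prim_root.
have a0 : (a%:R : 'F_p) != 0.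
  by apply: contra_eqN ah => /eqP->; rewrite expr0n (eqn0Ngt p./2) half_gt0 prime_gt1 // eq_sym oner_eq0.
have [|[i _] /= Da] := prim_rootP zP (x := a%:R).
  have -> : p.-1 = (p./2 * 2)%N by rewrite {1}odd_prime_half /= muln2.
  by rewrite exprM ah expr1n.
have : (p.-1 %| i * p./2)%N by rewrite (prim_order_dvd zP) exprM -Da ah.
rewrite {1}odd_prime_half /= -mul2n dvdn_pmul2r ?half_gt0 ?prime_gt1 // => /dvdnP[j Dj].
exists (val (z ^+ j)); rewrite -!(val_Fp_nat p_pr).
by rewrite natrX natr_Zp -exprM -Dj Da.
Qed.

Lemma legendre_nonresidue : exists a, legendre p a = -1.
Proof.
have [z zP] := Fp_prim_root; exists (val z).
have zh : z ^+ p./2 != 1.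
  rewrite -(prim_order_dvd zP) {1}odd_prime_half /=.
  apply/negP => /dvdn_leq; rewrite half_gt0 prime_gt1 // => /(_ isT).
  have : (0 < p./2)%N by rewrite half_gt0 prime_gt1.
  lia.
rewrite /legendre natr_Zp (negPf zh) expf_eq0 (prim_root_eq0 zP).
have := prime_gt1 p_pr; by case: (p) => [|[|q]] //= _; rewrite andbF.
Qed.

End Legendre.

Lemma legendre_pred p : prime p -> odd p -> legendre p p.-1 = (-1) ^+ p./2.
Proof.
move=> p_pr p_odd; apply: (intr_sign_inj (Fp_two_neq0 p_pr p_odd)).
- exact: legendre_values.
- by rewrite -signr_odd; case: odd; constructor.
rewrite legendreE // rmorphXn rmorphN1; congr (_ ^+ _).
by apply/eqP; rewrite -addr_eq0 natr1 prednK ?prime_gt0 // pchar_Fp_0.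
Qed.

Section GaussSum.

Variables (p l : nat).
Hypotheses (p_pr : prime p) (p_odd : odd p) (l_pr : prime l) (l_odd : odd l) (pl : p != l).
Variables (L : finFieldType) (zeta : L).
Hypotheses (chL : l \in [pchar L]) (zetaP : p.-primitive_root zeta).

Let lg (x : 'F_p) : L := (legendre p x)%:~R.
Let z (x : 'F_p) : L := zeta ^+ x.
(** The quadratic Gauss sum modulo [p], formed in a field of characteristic [l]; computing [tau ^ l]
    in two ways gives reciprocity. *)
Let tau := \sum_x lg x * z x.

Let lgM x y : lg (x * y) = lg x * lg y.
Proof.
rewrite /lg -rmorphM -legendreM //; congr _%:~R; apply: legendre_mod => //.
by rewrite -!(val_Fp_nat p_pr) natrM !natr_Zp.
Qed.

Let z_nat a : z a%:R = zeta ^+ a.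
Proof. by rewrite /z val_Fp_nat // (prim_expr_mod zetaP). Qed.

Let zD x y : z (x + y) = z x * z y.
Proof. by rewrite -(natr_Zp x) -(natr_Zp y) -natrD !z_nat exprD. Qed.

Let lg_nat a : lg a%:R = (legendre p a)%:~R.
Proof.
by rewrite /lg val_Fp_nat //; congr _%:~R; apply: legendre_mod; rewrite ?modn_mod.
Qed.

Let z_sum c : \sum_x z (x * c) = if c == 0 then p%:R else 0.
Proof.
case: eqP => [->|/eqP c0].
  under eq_bigr do rewrite mulr0 /z expr0.
  by rewrite sumr_const card_Fp.
transitivity (\sum_x z x); first by rewrite [RHS](reindex_inj (mulIf c0)).
have z1 : z 1 != 1.
  rewrite -[1]/(1%:R) z_nat -(prim_order_dvd zetaP) dvdn1.
  by rewrite gtn_eqF ?prime_gt1.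
have : z 1 * \sum_x z x = \sum_x z x.
  rewrite [RHS](reindex_inj (addrI 1)) mulr_sumr.
  by apply: eq_bigr => x _; rewrite zD.
move/eqP; rewrite -subr_eq0 -[X in _ - X]mul1r -mulrBl mulf_eq0 subr_eq0 (negPf z1) /=.
by move/eqP.
Qed.

Let L_two_neq0 : 2%:R != 0 :> L.
Proof.
rewrite -(dvdn_pcharf chL); apply/negP => /dvdn_leq => /(_ isT).
by rewrite leqNgt odd_prime_gt2.
Qed.

Let lg_sum : \sum_x lg x = 0.
Proof.
have [a la] := legendre_nonresidue p_pr p_odd.
have a0 : (a%:R : 'F_p) != 0.
  apply/eqP => a0; have := lg_nat a; rewrite a0 -[0]/(0%:R) lg_nat la => /eqP.
  rewrite (_ : legendre p 0 = 0).
    by rewrite eq_sym rmorphN1 oppr_eq0 oner_eq0.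
  have := legendre_sqr p_pr p_odd 0; rewrite /coprime gcd0n.
  by rewrite gtn_eqF ?prime_gt1 // => /eqP; rewrite sqrf_eq0 => /eqP.
have : \sum_x lg x = - \sum_x lg x.
  rewrite {1}(reindex_inj (mulfI a0)) -mulN1r mulr_sumr; apply: eq_bigr => x _.
  by rewrite lgM lg_nat la rmorphN1.
move/eqP; rewrite -addr_eq0 -mulr2n -mulr_natl mulf_eq0 (negPf L_two_neq0) /=.
by move/eqP.
Qed.

Let lg_sqr x : x != 0 -> lg x ^+ 2 = 1.
Proof.
move=> x0; rewrite /lg -rmorphXn legendre_sqr // coprime_sym prime_coprime //.
by rewrite -Fp_natr_eq0 // natr_Zp x0.
Qed.

Let lg0 : lg 0 = 0.
Proof.
have [a la] := legendre_nonresidue p_pr p_odd.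
have := lgM a%:R 0; rewrite mulr0 lg_nat la rmorphN1 mulN1r => /eqP.
by rewrite -addr_eq0 -mulr2n -mulr_natl mulf_eq0 (negPf L_two_neq0) /= => /eqP.
Qed.

(** After rescaling the second summation variable by [x], the sum of [z (x (1 + u))] over all [x]
    vanishes unless [u = -1]; the missing terms at [x = 0] add up to the sum of [lg], which is 0. *)
Let tau_sqr : tau ^+ 2 = lg (-1) * p%:R.
Proof.
rewrite expr2 {1}/tau mulr_suml.
transitivity (\sum_(x | x != 0) \sum_u lg u * z (x * (1 + u))).
  rewrite (bigD1 0) //= lg0 !mul0r add0r; apply: eq_bigr => x x0.
  rewrite /tau mulr_sumr (reindex_inj (mulfI x0)); apply: eq_bigr => u _.
  rewrite lgM mulrDr mulr1 zD -[RHS]mul1r -(lg_sqr x0); ring.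
rewrite exchange_big /=.
transitivity (\sum_u (lg u * (if u == -1 then p%:R else 0) - lg u)).
  apply: eq_bigr => u _; rewrite -mulr_sumr -[X in _ = _ - X]mulr1 -mulrBr.
  congr (_ * _); rewrite -(addrC u) -addr_eq0 -z_sum [X in _ = X - _](bigD1 0) //= mul0r.
  by rewrite (z_nat 0) expr0 addrAC subrr add0r.
rewrite sumrB lg_sum subr0 (bigD1 (-1)) //= eqxx big1 ?addr0 // => u /negPf->.
by rewrite mulr0.
Qed.

(** Frobenius fixes the signs [lg x] and raises [zeta] to the power [l]; reindexing by [x -> x l]
    extracts the symbol of [l]. *)
Let tau_frobenius : tau ^+ l = (legendre p l)%:~R * tau.
Proof.
have lgl x : lg x ^+ l = lg x.
  have [->|x0] := eqVneq x 0; first by rewrite lg0 expr0n (gtn_eqF (prime_gt0 l_pr)).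
  by rewrite (odd_prime_half l_odd) exprS -mul2n exprM lg_sqr // expr1n mulr1.
have l0 : (l%:R : 'F_p) != 0.
  by rewrite Fp_natr_eq0 // dvdn_prime2 // eq_sym.
rewrite -(pFrobenius_autE chL) /tau rmorph_sum mulr_sumr /=.
rewrite [RHS](reindex_inj (mulIf l0)) /=; apply: eq_bigr => x _.
rewrite pFrobenius_autE exprMn lgl -lg_nat lgM mulrA.
rewrite [lg _ * (lg x * _)]mulrCA -expr2 lg_sqr // mulr1; congr (_ * _).
by rewrite -(natr_Zp x) -natrM !z_nat exprM.
Qed.

(** [tau ^ (l - 1)] is the power [(l - 1) / 2] of [tau ^ 2], which Euler's criterion modulo [l]
    evaluates. *)
Lemma legendre_reciprocity_char : (legendre p l)%:~R =
  ((-1) ^+ (p./2 * l./2) * legendre l p)%:~R :> L.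
Proof.
have p0 : p%:R != 0 :> L by exact: prim_root_natf_neq0 zetaP.
have lgN1 : lg (-1) = (-1) ^+ p./2.
  have -> : -1 = p.-1%:R :> 'F_p.
    by apply/eqP; rewrite eq_sym -addr_eq0 natr1 prednK ?prime_gt0 // pchar_Fp_0.
  by rewrite lg_nat legendre_pred // rmorphXn rmorphN1.
have tau0 : tau != 0.
  by rewrite -sqrf_eq0 tau_sqr lgN1 mulf_neq0 // expf_neq0 // oppr_eq0 oner_neq0.
have := tau_frobenius; rewrite {1}(odd_prime_half l_odd) exprSr -mul2n exprM tau_sqr.
move/(mulIf tau0) => <-; rewrite lgN1 exprMn -exprM rmorphM rmorphXn rmorphN1.
congr (_ * _).
(* Euler's criterion holds in ['F_l] and passes to [L] as a divisibility by the common
   characteristic [l]. *)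
have := legendreE l_pr l_odd p => /eqP.
rewrite -subr_eq0 -natrX pmulrn -rmorphB -(dvdz_pcharf (pchar_Fp l_pr)).
by rewrite (dvdz_pcharf chL) rmorphB /= subr_eq0 -pmulrn natrX => /eqP->.
Qed.

End GaussSum.

Theorem legendre_reciprocity p l : prime p -> odd p -> prime l -> odd l -> p != l ->
  legendre p l = (-1) ^+ (p./2 * l./2) * legendre l p.
Proof.
move=> p_pr p_odd l_pr l_odd pl.
have cpl : coprime l p by rewrite prime_coprime // dvdn_prime2 // eq_sym.
have [L [zeta [chL zetaP]]] := pchar_field_prim_root l_pr (prime_gt0 p_pr) cpl.
have two_neq0 : 2%:R != 0 :> L.
  rewrite -(dvdn_pcharf chL); apply/negP => /dvdn_leq => /(_ isT).
  by rewrite leqNgt odd_prime_gt2.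
apply: (intr_sign_inj two_neq0).
- exact: legendre_values.
- rewrite -signr_odd; case: odd; rewrite ?expr1 ?expr0 ?mul1r ?mulN1r; last exact: legendre_values.
  by case: (legendre_values l p) => ->; rewrite ?opprK ?oppr0; [constructor 2|constructor 1|constructor 3].
exact: legendre_reciprocity_char zetaP.
Qed.

(** * Norms in a prescribed class *)

Definition chi4 (a : nat) : int := nth 0 [:: 0; 1; 0; -1] (a %% 4).
Definition chi8 (a : nat) : int := nth 0 [:: 0; 1; 0; -1; 0; -1; 0; 1] (a %% 8).

Lemma real_char_table (M : nat) (T : seq int) : (0 < M)%N ->
    all (fun i => all (fun j => T`_(i * j %% M) == T`_i * T`_j) (iota 0 M)) (iota 0 M) ->
    all (fun i => T`_i ^+ 2 == (coprime i M)%:R) (iota 0 M) ->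
  real_char M (fun a => T`_(a %% M)).
Proof.
move=> M_gt0 /allP TM /allP T2.
have mem a : (a %% M)%N \in iota 0 M by rewrite mem_iota /= ltn_mod.
split=> [m n|m|m]; last by rewrite (eqP (T2 _ (mem m))) coprime_modl.
  by rewrite -modnMm (eqP (allP (TM _ (mem m)) _ (mem n))).
by rewrite modnDr.
Qed.

Lemma chi4P : real_char 4 chi4.
Proof. by apply: real_char_table; vm_compute. Qed.

Lemma chi8P : real_char 8 chi8.
Proof. by apply: real_char_table; vm_compute. Qed.

Lemma chi4_odd a : odd a -> chi4 a = (-1) ^+ a./2.
Proof.
move=> a_odd; rewrite -signr_odd /chi4.
have [->|->] : (a %% 4 = (odd a./2).*2.+1)%N \/ (a %% 4 = (odd a./2).*2.+1)%N by left; lia.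
all: by case: odd.
Qed.

(** With [z] a primitive 8th root of unity, [z + z ^ 7] is a square root of 2, and Frobenius
    multiplies it by [chi8 l]. *)
Lemma legendre_two l : prime l -> odd l -> legendre l 2 = chi8 l.
Proof.
move=> l_pr l_odd.
have cl8 : coprime l 8 by rewrite (@coprime_pexpr 3 l 2) // coprime_sym coprime2n.
have [L [z [chL zP]]] := pchar_field_prim_root l_pr (isT : 0 < 8)%N cl8.
have two_neq0 : 2%:R != 0 :> L.
  rewrite -(dvdn_pcharf chL); apply/negP => /dvdn_leq => /(_ isT).
  by rewrite leqNgt odd_prime_gt2.
have z4 : z ^+ 4 = -1.
  have /eqP : (z ^+ 4) ^+ 2 = 1 by rewrite -exprM (prim_expr_order zP).
  by rewrite sqrf_eq1 -(prim_order_dvd zP) /= => /eqP.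
have zE i j : i = j %[mod 8] -> z ^+ i = z ^+ j.
  by rewrite -(prim_expr_mod zP i) => ->; rewrite prim_expr_mod.
pose tau := z + z ^+ 7.
have tau2 : tau ^+ 2 = 2%:R.
  rewrite sqrrD -exprS (prim_expr_order zP) -exprM (zE (7 * 2) (2 + 4))%N //.
  by rewrite exprD z4 mulrN1 addrAC subrr add0r.
have tau0 : tau != 0 by rewrite -sqrf_eq0 tau2.
have taul : tau ^+ l = (chi8 l)%:~R * tau.
  rewrite -(pFrobenius_autE chL) rmorphD /= !pFrobenius_autE -exprM.
  have : (l %% 8 = 1 \/ l %% 8 = 3 \/ l %% 8 = 5 \/ l %% 8 = 7)%N by lia.
  have e3 : z ^+ 3 = - z ^+ 7 by rewrite (exprD z 3 4) z4 mulrN1 opprK.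
  have e5 : z ^+ 5 = - z by rewrite (exprD z 1 4) z4 mulrN1.
  have zl : z ^+ l = z ^+ (l %% 8) by rewrite (prim_expr_mod zP).
  have z7l : z ^+ (7 * l) = z ^+ ((7 * (l %% 8)) %% 8).
    by rewrite modnMmr (prim_expr_mod zP).
  rewrite zl z7l /tau /chi8 => -[|[|[|]]] -> /=.
  - by rewrite mul1r.
  - by rewrite -[z ^+ 5]/(z ^+ 5) e3 e5 rmorphN1 mulN1r opprD addrC.
  - by rewrite -[z ^+ 3]/(z ^+ 3) e3 e5 rmorphN1 mulN1r opprD.
  - by rewrite mul1r addrC.
apply: (intr_sign_inj two_neq0); [exact: legendre_values|exact: (real_char_values chi8P)|].
move: taul; rewrite {1}(odd_prime_half l_odd) exprSr -mul2n exprM tau2 => /(mulIf tau0) <-.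
have := legendreE l_pr l_odd 2 => /eqP.
rewrite -subr_eq0 -natrX pmulrn -rmorphB -(dvdz_pcharf (pchar_Fp l_pr)).
by rewrite (dvdz_pcharf chL) rmorphB /= subr_eq0 -pmulrn natrX => /eqP->.
Qed.

(* [kronecker p] is the quadratic character of conductor dividing [8 p] whose value
   at an odd prime [l <> p] is the Legendre symbol (p/l). *)
Definition kronecker (p a : nat) : int :=
  if p == 2%N then chi8 a else legendre p a * chi4 a ^+ p./2.

Lemma kronecker_legendre p l : prime p -> prime l -> odd l -> p != l ->
  kronecker p l = legendre l p.
Proof.
move=> p_pr l_pr l_odd pl; rewrite /kronecker; case: eqP => [->|/eqP p2].
  by rewrite legendre_two.
have p_odd : odd p by case: (even_prime p_pr) => // p2'; rewrite p2' in p2.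
rewrite legendre_reciprocity // chi4_odd // mulrAC -exprM -exprD mulnC addnn -muln2.
by rewrite exprM sqrr_sign mul1r.
Qed.

Lemma kroneckerM p a b : prime p -> kronecker p (a * b) = kronecker p a * kronecker p b.
Proof.
move=> p_pr; rewrite /kronecker; case: eqP => [_|/eqP p2]; first exact: (real_charM chi8P).
have p_odd : odd p by case: (even_prime p_pr) => // p2'; rewrite p2' in p2.
by rewrite legendreM // (real_charM chi4P) exprMn mulrACA.
Qed.

Lemma kronecker_eqmod p a b : prime p -> a = b %[mod 8 * p] -> kronecker p a = kronecker p b.
Proof.
have H d q : (d %| q)%N -> a = b %[mod q] -> a = b %[mod d].
  by move=> dq eq; rewrite -(modn_dvdm a dq) eq modn_dvdm.
move=> p_pr eq; rewrite /kronecker.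
rewrite (real_char_eqmod chi8P (H _ _ (dvdn_mulr p (dvdnn 8)) eq)).
rewrite (real_char_eqmod chi4P (H 4 _ (dvdn_mulr p (isT : 4 %| 8)%N) eq)).
by rewrite (legendre_mod p_pr (H _ _ (dvdn_mull 8 (dvdnn p)) eq)).
Qed.

Lemma kronecker_sqr p a : prime p -> odd a -> kronecker p a ^+ 2 = (coprime a p)%:R.
Proof.
move=> p_pr a_odd; rewrite /kronecker; case: eqP => [->|/eqP p2].
  by rewrite (real_char_sqr chi8P) (@coprime_pexpr 3 a 2).
have p_odd : odd p by case: (even_prime p_pr) => // p2'; rewrite p2' in p2.
by rewrite exprMn legendre_sqr // chi4_odd // -exprM mulnC exprM sqrr_sign expr1n mulr1.
Qed.

(** The quadratic character of [-N], where [N] is the product of [s] with repetitions allowed;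
    [chi4] accounts for the sign. *)
Definition chi_neg (s : seq nat) (a : nat) : int := chi4 a * \prod_(p <- s) kronecker p a.

Lemma prod_kronecker_eqmod s a b : all prime s -> a = b %[mod 8 * \prod_(p <- s) p] ->
  \prod_(p <- s) kronecker p a = \prod_(p <- s) kronecker p b.
Proof.
move=> /allP s_pr eq; apply: eq_big_seq => p ps; apply: kronecker_eqmod; first exact: s_pr.
have dv : (8 * p %| 8 * \prod_(q <- s) q)%N.
  by rewrite dvdn_pmul2l // (big_rem p) //= dvdn_mulr.
by rewrite -(modn_dvdm a dv) eq modn_dvdm.
Qed.

Lemma chi_negP s : all prime s -> real_char (8 * \prod_(p <- s) p) (chi_neg s).
Proof.
move=> s_pr; split=> [m n|m|m]; rewrite /chi_neg.
- rewrite (real_charM chi4P) mulrACA -big_split /=; congr (_ * _).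
  by apply: eq_big_seq => p /(allP s_pr) p_pr; rewrite kroneckerM.
- rewrite (@prod_kronecker_eqmod s _ m) ?modnDr //; congr (_ * _).
  by apply: (real_char_eqmod chi4P); rewrite -modnDmr (_ : 8 = 4 * 2)%N // -mulnA modnMr addn0.
rewrite exprMn (real_char_sqr chi4P) coprimeMr.
have -> : coprime m 8 = coprime m 4.
  by rewrite (@coprime_pexpr 3 m 2) // (@coprime_pexpr 2 m 2).
rewrite (@coprime_pexpr 2 m 2) // [coprime m 2]coprime_sym coprime2n.
case: (boolP (odd m)) => m_odd; last by rewrite mul0r.
rewrite mul1r /=; elim: s s_pr => [|p s IHs] /=; first by rewrite !big_nil coprimen1.
by case/andP=> p_pr s_pr; rewrite !big_cons exprMn kronecker_sqr // IHs // coprimeMr -natrM mulnb.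
Qed.

Lemma prod_kronecker_prime s l : all prime s -> prime l -> odd l -> {in s, forall p, p != l} ->
  \prod_(p <- s) kronecker p l = legendre l (\prod_(p <- s) p).
Proof.
move=> s_pr l_pr l_odd; elim: s s_pr => [|p s IHs] /= s_pr sl.
  rewrite !big_nil; have := legendreM l_pr l_odd 1 1.
  by have := legendre_sqr l_pr l_odd 1; rewrite coprime1n muln1 -expr2 => ->.
case/andP: s_pr => p_pr s_pr; rewrite !big_cons legendreM // kronecker_legendre ?sl ?mem_head //.
by rewrite IHs // => q qs; rewrite sl // inE qs orbT.
Qed.

Lemma chi_neg_prime s l : all prime s -> prime l -> coprime l (8 * \prod_(p <- s) p) ->
  chi_neg s l = 1 -> exists x, (l %| x ^ 2 + \prod_(p <- s) p)%N.
Proof.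
set N := (\prod_(p <- s) p)%N; move=> s_pr l_pr; rewrite coprimeMr => /andP[cl8 clN].
have l_odd : odd l.
  by move: cl8; rewrite (@coprime_pexpr 3 l 2) // coprime_sym coprime2n.
(* [l.-1] plays the part of -1 modulo [l]. *)
have -> : chi_neg s l = legendre l (l.-1 * N).
  rewrite legendreM // legendre_pred // -chi4_odd // -prod_kronecker_prime // => p ps.
  apply: contraL clN => /eqP pl; rewrite prime_coprime // negbK -pl /N.
  by rewrite (big_rem p) //= dvdn_mulr.
move/(legendre1_sqr l_pr l_odd) => [x ex]; exists x.
rewrite /dvdn -modnDml ex modnDml -{2}[N]mul1n -mulnDl addn1 prednK ?prime_gt0 //.
by rewrite modnMr.
Qed.

Lemma dvdn_linear l a c : prime l -> coprime l a -> exists k, (l %| a * k + c)%N.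
Proof.
move=> l_pr cla; exists (- (c%:R / a%:R) : 'F_l).
have a0 : (a%:R : 'F_l) != 0 by rewrite Fp_natr_eq0 // -prime_coprime.
rewrite -Fp_natr_eq0 // natrD natrM natr_Zp mulrN mulrCA mulfV // mulr1.
by rewrite addNr.
Qed.

(** Look for [z = x + A k]. If [l] does not divide [A], the Chinese remainder theorem gives [z = y]
    modulo [l]; if it does, this is a Hensel step, [2 x] being invertible modulo [l]. *)
Lemma dvdn_sqrD_lift A l x y N : prime l -> odd l -> coprime l N ->
  (A %| x ^ 2 + N)%N -> (l %| y ^ 2 + N)%N -> exists z, (l * A %| z ^ 2 + N)%N.
Proof.
move=> l_pr l_odd clN dA dl; have [clA|] := boolP (coprime l A).
  have [k dk] := dvdn_linear (x + l.-1 * y) l_pr clA.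
  exists (x + A * k)%N; rewrite Gauss_dvd //; apply/andP; split; last first.
    have -> : ((x + A * k) ^ 2 + N = (x ^ 2 + N) + A * (2 * x * k + A * k ^ 2))%N by nia.
    by rewrite dvdn_addl // dvdn_mulr.
  move: dk dl; rewrite -!Fp_natr_eq0 // => /eqP dk /eqP <-; apply/eqP.
  have -> : ((x + A * k) ^ 2 + N)%:R = (x + A * k)%:R ^+ 2 + N%:R :> 'F_l by rewrite natrD natrX.
  rewrite [(y ^ 2 + N)%:R]natrD natrX; congr (_ ^+ 2 + _).
  apply/eqP; rewrite -subr_eq0 -dk; apply/eqP.
  have -> : (A * k + (x + l.-1 * y) = (x + A * k) + l.-1 * y)%N by lia.
  rewrite [RHS]natrD natrM; congr (_ + _); rewrite -mulN1r; congr (_ * _).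
  by apply/eqP; rewrite eq_sym -addr_eq0 natr1 prednK ?prime_gt0 // pchar_Fp_0.
rewrite prime_coprime // negbK => /dvdnP[A' DA].
have /dvdnP[q Dq] := dA.
have cx : coprime l (2 * x).
  rewrite coprimeMr coprimen2 l_odd /=; apply: contraLR clN.
  rewrite !prime_coprime // !negbK => dx.
  by rewrite -(dvdn_addr N (dvdn_mulr x dx)) mulnn (dvdn_trans _ dA) // DA dvdn_mull.
have [k dk] := dvdn_linear q l_pr cx.
exists (x + A * k)%N.
have -> : ((x + A * k) ^ 2 + N = (x ^ 2 + N) + A * (2 * x * k + A * k ^ 2))%N by nia.
rewrite Dq [(q * A)%N]mulnC -mulnDr mulnC addnCA addnA; apply: dvdn_mul => //.
by rewrite dvdn_add // DA -mulnA dvdn_mull // dvdn_mulr.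
Qed.

Lemma dvdn_sqrD_prime_factors A N : (0 < A)%N ->
    (forall l, prime l -> (l %| A)%N ->
       [/\ odd l, coprime l N & exists x, (l %| x ^ 2 + N)%N]) ->
  exists x, (A %| x ^ 2 + N)%N.
Proof.
have [n] := ubnP A; elim: n A => // n IHn A ltAn A_gt0 HA.
have [A1|A1] := leqP A 1; first by exists 0%N; have -> : A = 1%N by lia.
have l_pr := pdiv_prime A1; have /dvdnP[B DB] := pdiv_dvd A.
have [l_odd clN [y dy]] := HA _ l_pr (pdiv_dvd A).
have l1 := prime_gt1 l_pr.
have [||l' l'_pr l'B|x dx] := IHn B.
- by nia.
- by nia.
- by apply: HA => //; rewrite DB dvdn_mulr.
have [z dz] := dvdn_sqrD_lift l_pr l_odd clN dx dy.
by exists z; rewrite DB mulnC.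
Qed.

Theorem exists_norm_in_class s t : all prime s -> chi_neg s t = 1 ->
  let N := (\prod_(p <- s) p)%N in
  exists A r B, [/\ (0 < A)%N, coprime A (8 * N), coprime r (8 * N),
    A = t * r ^ 2 %[mod 8 * N] & (A %| B ^ 2 + N)%N].
Proof.
move=> s_pr chit N.
have N_gt0 : (0 < N)%N.
  by rewrite /N big_seq prodn_cond_gt0 // => p /(allP s_pr)/prime_gt0.
have [|A [r [A_gt0 cr eA fA]]] := real_char_kernel_mod_squares _ (chi_negP s_pr) chit.
  by rewrite -/N; lia.
have [|B dB] := @dvdn_sqrD_prime_factors A N A_gt0.
  move=> l l_pr dl; have [cl chil] := fA l l_pr dl.
  have [x dx] := chi_neg_prime s_pr l_pr cl chil.
  move: cl; rewrite coprimeMr (@coprime_pexpr 3 l 2) // coprimen2 => /andP[-> ->].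
  by split=> //; exists x.
exists A, r, B; split=> //.
rewrite coprime_has_primes ?muln_gt0 ?N_gt0 //.
apply/hasPn => p; rewrite mem_primes => /and3P[p_pr _ pN].
rewrite mem_primes p_pr A_gt0 /=; apply/negP => /(fA p p_pr)[].
by rewrite prime_coprime // pN.
Qed.

Lemma prime_factor_list n : (0 < n)%N ->
  exists2 s, all prime s & (\prod_(p <- s) p)%N = n.
Proof.
have [m] := ubnP n; elim: m n => // m IHm n ltnm n_gt0.
have [n1|n1] := leqP n 1; first by exists [::] => //; rewrite big_nil; lia.
have p_pr := pdiv_prime n1; have p1 := prime_gt1 p_pr; have /dvdnP[k Dk] := pdiv_dvd n.
have [||s s_pr Ds] := IHm k; [nia|nia|].
by exists (pdiv n :: s); rewrite /= ?p_pr // big_cons Ds mulnC.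
Qed.

Lemma coprime_dvdS t m : (m %| t.+1)%N -> coprime t m.
Proof. by move=> dm; apply: coprime_dvdr dm (coprimenS t). Qed.

(** Here [t = -1] modulo [d], so [-A] becomes a square modulo [d]. *)
Lemma dvdn_class_add A t r M d : (d %| M)%N -> (d %| t.+1)%N ->
  A = t * r ^ 2 %[mod M] -> (d %| A + r ^ 2)%N.
Proof.
move=> dM dt eA; have eAd : A = t * r ^ 2 %[mod d].
  by rewrite -(modn_dvdm A dM) eA modn_dvdm.
by rewrite /dvdn -modnDml eAd modnDml -mulSnr; apply: dvdn_mulr.
Qed.

Lemma legendre_pred1 p t : prime p -> odd p -> (p %| t.+1)%N ->
  legendre p t = (-1) ^+ p./2.
Proof.
move=> p_pr p_odd dt; rewrite -legendre_pred //; apply: legendre_mod => //.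
apply/eqP; rewrite -(eqn_modDr 1) !addn1 prednK ?prime_gt0 // modnn.
exact: dt.
Qed.

(** As [t] is -1 modulo each [p] and 1 modulo 4, each factor is the Legendre symbol of -1, that is
    [chi4 p]. *)
Lemma prod_kronecker_pred s t : all prime s -> odd (\prod_(p <- s) p) -> chi4 t = 1 ->
  (\prod_(p <- s) p %| t.+1)%N -> \prod_(p <- s) kronecker p t = chi4 (\prod_(p <- s) p).
Proof.
move=> + + t4; elim: s => [|p s IHs] /=; first by rewrite !big_nil.
rewrite !big_cons oddM => /andP[p_pr s_pr] /andP[p_odd s_odd] dt.
have dp : (p %| t.+1)%N by apply: dvdn_trans dt; rewrite dvdn_mulr.
rewrite (real_charM chi4P) IHs ?(dvdn_trans _ dt) ?dvdn_mull //.
rewrite /kronecker ifN ?legendre_pred1 // ?t4 ?expr1n ?mulr1 ?chi4_odd //.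
by apply: contraL p_odd => /eqP->.
Qed.

Lemma prod_kronecker_odd_eqmod s a b : all prime s -> odd (\prod_(p <- s) p) ->
    chi4 a = chi4 b -> a = b %[mod \prod_(p <- s) p] ->
  \prod_(p <- s) kronecker p a = \prod_(p <- s) kronecker p b.
Proof.
move=> /allP s_pr s_odd ab4 eq; apply: eq_big_seq => p ps.
have dp : (p %| \prod_(q <- s) q)%N by rewrite (big_rem p) //= dvdn_mulr.
have p2 : p != 2%N by apply: contraL (dvdn_odd dp s_odd) => /eqP->.
have ep : a = b %[mod p] by rewrite -(modn_dvdm a dp) eq modn_dvdm.
by rewrite /kronecker (negPf p2) ab4 (legendre_mod (s_pr _ ps) ep).
Qed.

(** The data for gluing: [-A = r ^ 2] modulo [D], and [-N = B ^ 2] modulo [A]. *)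
Definition neg_square_norm (D m N : nat) : Prop :=
  exists A r B, [/\ (0 < A)%N, coprime A m, coprime r m,
    (D %| A + r ^ 2)%N & (A %| B ^ 2 + N)%N].

Lemma chi_neg_square_norm s t D : all prime s -> chi_neg s t = 1 ->
    let N := (\prod_(p <- s) p)%N in (D %| 8 * N)%N -> (D %| t.+1)%N ->
  neg_square_norm D (8 * N) N.
Proof.
move=> s_pr chit N dN dt.
have [A [r [B [A_gt0 cA cr eA dB]]]] := exists_norm_in_class s_pr chit.
by exists A, r, B; split=> //; apply: dvdn_class_add eA.
Qed.

Lemma neg_square_norm_mod4 (m : nat) : (m %% 4 = 1)%N -> neg_square_norm m (8 * m) m.
Proof.
move=> m1; have m_gt0 : (0 < m)%N by lia.
have [s s_pr Ds] := prime_factor_list m_gt0.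
(* This [t] is -1 modulo [m] and 1 modulo 4, so its character value is [chi4 m = 1]. *)
pose t := (2 * m).-1; have t1 : t.+1 = (2 * m)%N by rewrite prednK //; lia.
have t4 : chi4 t = 1 by rewrite /chi4 (_ : t %% 4 = 1)%N //; lia.
have chit : chi_neg s t = 1.
  rewrite /chi_neg t4 mul1r prod_kronecker_pred // Ds ?t1 ?dvdn_mull //; last by lia.
  by rewrite /chi4 m1.
by rewrite -{2 3}Ds; apply: (chi_neg_square_norm s_pr chit); rewrite ?Ds ?t1 dvdn_mull.
Qed.

Lemma chi8_flip a b : odd a -> (b = a + 4 %[mod 8])%N -> chi8 b = - chi8 a.
Proof.
move=> a_odd eb; rewrite /chi8 eb -modnDml.
have : (a %% 8 = 1 \/ a %% 8 = 3 \/ a %% 8 = 5 \/ a %% 8 = 7)%N by lia.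
by case=> [|[|[]]] ->; vm_compute.
Qed.

(** It is enough to produce two candidates of opposite sign, without computing either value. *)
Lemma chi_neg_flip (P : nat -> Prop) s t1 t2 : all prime s ->
    coprime t1 (8 * \prod_(p <- s) p) -> chi_neg s t2 = - chi_neg s t1 ->
  P t1 -> P t2 -> exists2 t, chi_neg s t = 1 & P t.
Proof.
move=> s_pr ct1 flip P1 P2.
case: (real_char_coprime (chi_negP s_pr) ct1) => e; first by exists t1.
by exists t2; rewrite // flip e opprK.
Qed.

Lemma neg_square_norm_mod2 (m : nat) : (m %% 4 = 2)%N -> neg_square_norm m (8 * m) m.
Proof.
move=> m2; pose k := m./2; have Dm : m = (2 * k)%N by rewrite /k; lia.
have k_odd : odd k by lia.
have k_gt0 : (0 < k)%N by lia.
have [s s_pr Ds] := prime_factor_list k_gt0.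
have s2_pr : all prime (2 :: s) by rewrite /= s_pr.
have Ds2 : (\prod_(p <- 2 :: s) p = m)%N by rewrite big_cons Ds.
(* Both are -1 modulo [m]; they differ by [4 k] with [k] odd, so only the factor [chi8] changes
   sign. *)
pose t1 := m.-1; pose t2 := (3 * m).-1.
have St1 : t1.+1 = m by rewrite prednK; lia.
have St2 : t2.+1 = (3 * m)%N by rewrite prednK; lia.
have t1_odd : odd t1 by lia.
have t12 : chi4 t2 = chi4 t1 by apply: (real_char_eqmod chi4P); lia.
have flip : chi_neg (2 :: s) t2 = - chi_neg (2 :: s) t1.
  rewrite /chi_neg !big_cons /= {1 3}/kronecker /= (@chi8_flip t1 t2) //; last by lia.
  rewrite (@prod_kronecker_odd_eqmod s t2 t1) ?Ds // ?t12; first by ring.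
  have -> : t2 = (4 * k + t1)%N by lia.
  by rewrite modnMDl.
have [|||t chit dt] := @chi_neg_flip (fun t => (m %| t.+1)%N) _ t1 t2 s2_pr _ flip.
- rewrite Ds2 coprimeMr [coprime t1 m]coprime_dvdS ?St1 // andbT.
  by rewrite (@coprime_pexpr 3 t1 2) // coprimen2.
- by rewrite St1.
- by rewrite St2 dvdn_mull.
by rewrite -{2 3}Ds2; apply: (chi_neg_square_norm s2_pr chit); rewrite ?Ds2 ?dvdn_mull.
Qed.

Lemma neg_square_norm_3n (n : nat) : (0 < n)%N -> coprime n 3 ->
  neg_square_norm (4 * n) (8 * (3 * n)) (3 * n).
Proof.
move=> n_gt0 cn3; have n3 : (n %% 3 = 1 \/ n %% 3 = 2)%N.
  by move: cn3; rewrite coprime_sym prime_coprime // /dvdn; lia.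
have [s s_pr Ds] := prime_factor_list n_gt0.
have s3_pr : all prime (3 :: s) by rewrite /= s_pr.
have Ds3 : (\prod_(p <- 3 :: s) p = 3 * n)%N by rewrite big_cons Ds.
(* Both are -1 modulo [8 n]; modulo 3 the first is [2 n ^ 2 - 1 = 1] and the second is 2, so only
   the factor at 3 changes sign. *)
pose t1 := (8 * n * (n %% 3)).-1; pose t2 := (24 * n).-1.
have St1 : t1.+1 = (8 * n * (n %% 3))%N by rewrite prednK; nia.
have St2 : t2.+1 = (24 * n)%N by rewrite prednK; lia.
have t13 : (t1 = 1 %[mod 3])%N by case: n3 => e; move: St1; rewrite e; lia.
have t23 : (t2 = 2 %[mod 3])%N by lia.
have t12 : (t1 = t2 %[mod 8 * n])%N.
  apply/eqP; rewrite -(eqn_modDr 1) !addn1 St1 St2 modnMr.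
  by rewrite (_ : 24 * n = 3 * (8 * n))%N ?modnMl //; lia.
have d4 : (4 %| 8 * n)%N by exact: dvdn_mulr n (isT : 4 %| 8)%N.
have t124 : chi4 t2 = chi4 t1.
  by apply: (real_char_eqmod chi4P); rewrite -(modn_dvdm t2 d4) -t12 modn_dvdm.
have leg31 : legendre 3 t1 = 1.
  rewrite (legendre_mod (isT : prime 3) t13).
  have := @legendreM 3 isT isT 1 1; have := @legendre_sqr 3 isT isT 1.
  by rewrite coprime1n muln1 expr2 => ->.
have leg32 : legendre 3 t2 = -1.
  by rewrite (legendre_mod (isT : prime 3) t23) (@legendre_pred 3).
have flip : chi_neg (3 :: s) t2 = - chi_neg (3 :: s) t1.
  rewrite /chi_neg !big_cons (@prod_kronecker_eqmod s t2 t1) ?Ds // /kronecker /= leg31 leg32 t124.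
  by ring.
have [|||t chit dt] := @chi_neg_flip (fun t => (8 * n %| t.+1)%N) _ t1 t2 s3_pr _ flip.
- have ct1 : coprime t1 (8 * n) by apply: coprime_dvdS; rewrite St1 dvdn_mulr.
  by rewrite Ds3 mulnCA coprimeMr ct1 andbT coprime_sym -coprime_modr t13.
- by rewrite St1 dvdn_mulr.
- have -> : t2.+1 = (3 * (8 * n))%N by rewrite St2 mulnA.
  exact: dvdn_mull (dvdnn _).
rewrite -Ds3; apply: (chi_neg_square_norm s3_pr chit).
  have -> : (8 * \prod_(p <- 3 :: s) p = 6 * (4 * n))%N by rewrite Ds3 !mulnA.
  exact: dvdn_mull (dvdnn _).
apply: dvdn_trans dt; have -> : (8 * n = 2 * (4 * n))%N by rewrite mulnA.
exact: dvdn_mull (dvdnn _).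
Qed.

End QuadraticCharacters.

Local Arguments Z.pow : simpl never.
Local Arguments Z.mul : simpl never.
Local Arguments Z.add : simpl never.
Local Arguments Z.sub : simpl never.

(** * Reduction of ternary forms *)

Record ternary := Ternary { cxx : Z; cyy : Z; czz : Z; cyz : Z; cxz : Z; cxy : Z }.

Definition teval (f : ternary) (x y z : Z) : Z :=
  cxx f * x ^ 2 + cyy f * y ^ 2 + czz f * z ^ 2 + cyz f * y * z + cxz f * x * z + cxy f * x * y.

Definition minor (f : ternary) : Z := 4 * cxx f * cyy f - cxy f ^ 2.

(** Half the determinant of the Hessian matrix, an integer even when cross coefficients are odd: 4
    for the sum of three squares, 3 for [x ^ 2 + (y ^ 2 + y z + z ^ 2)]. *)
Definition half_disc (f : ternary) : Z :=
  4 * cxx f * cyy f * czz f + cyz f * cxz f * cxy f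
  - cxx f * cyz f ^ 2 - cyy f * cxz f ^ 2 - czz f * cxy f ^ 2.

(** Integrality of the Gram matrix; in a reduced form with leading coefficient 1 it forces [cxy] to
    be 0. *)
Definition classical (f : ternary) : Prop :=
  Z.Even (cyz f) /\ Z.Even (cxz f) /\ Z.Even (cxy f).

(** The part of integral equivalence that the reduction carries along. *)
Definition dominated (f g : ternary) : Prop :=
  half_disc g = half_disc f /\ (classical f -> classical g) /\
  forall x y z, exists x' y' z', teval g x' y' z' = teval f x y z.

Lemma dominated_trans f g h : dominated f g -> dominated g h -> dominated f h.
Proof.
move=> [d1 [e1 v1]] [d2 [e2 v2]]; split; first by rewrite d2.
split=> [/e1/e2 //|x y z].
have [x' [y' [z' <-]]] := v1 x y z.
exact: v2.
Qed.

Definition shift_xy k (f : ternary) : ternary :=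
  Ternary (cxx f) (cyy f + cxy f * k + cxx f * k ^ 2) (czz f)
          (cyz f + cxz f * k) (cxz f) (cxy f + 2 * cxx f * k).

Definition shift_yz k (f : ternary) : ternary :=
  Ternary (cxx f) (cyy f) (czz f + cyz f * k + cyy f * k ^ 2)
          (cyz f + 2 * cyy f * k) (cxz f + cxy f * k) (cxy f).

Definition swap_xy (f : ternary) : ternary :=
  Ternary (cyy f) (cxx f) (czz f) (cxz f) (cyz f) (cxy f).

Definition swap_yz (f : ternary) : ternary :=
  Ternary (cxx f) (czz f) (cyy f) (cyz f) (cxy f) (cxz f).

Lemma dominated_shift_xy k f : dominated f (shift_xy k f).
Proof.
case: f => a b c r s t; split; first by rewrite /half_disc /=; ring.
split=> [[[r' /= Er] [[s' /= Es] [t' /= Et]]]|x y z].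
  split; [|split]; rewrite /=.
  - by exists (r' + s' * k); rewrite Er Es; ring.
  - by exists s'.
  - by exists (t' + a * k); rewrite Et; ring.
by exists (x - k * y), y, z; rewrite /teval /=; ring.
Qed.

Lemma dominated_shift_yz k f : dominated f (shift_yz k f).
Proof.
case: f => a b c r s t; split; first by rewrite /half_disc /=; ring.
split=> [[[r' /= Er] [[s' /= Es] [t' /= Et]]]|x y z].
  split; [|split]; rewrite /=.
  - by exists (r' + b * k); rewrite Er; ring.
  - by exists (s' + t' * k); rewrite Es Et; ring.
  - by exists t'.
by exists x, (y - k * z), z; rewrite /teval /=; ring.
Qed.

Lemma dominated_swap_xy f : dominated f (swap_xy f).
Proof.
case: f => a b c r s t; split; first by rewrite /half_disc /=; ring.
split=> [[r' [s' t']] //|x y z].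
by exists y, x, z; rewrite /teval /=; ring.
Qed.

Lemma dominated_swap_yz f : dominated f (swap_yz f).
Proof.
case: f => a b c r s t; split; first by rewrite /half_disc /=; ring.
split=> [[r' [s' t']] //|x y z].
by exists x, z, y; rewrite /teval /=; ring.
Qed.

Lemma exists_centered_residue a t : 0 < a -> exists k, Z.abs (2 * (t + a * k)) <= a.
Proof.
(* An integer nearest to [- t / a]. *)
move=> a0; exists (- ((2 * t + a) / (2 * a))).
have := Z.div_mod (2 * t + a) (2 * a); have := Z.mod_pos_bound (2 * t + a) (2 * a).
set q := (_ / _); set m := (_ mod _); nia.
Qed.

(** The binary part in [x, y] is reduced in the sense of Lagrange; the last inequality is Hermite's
    bound for the binary form left by completing the square. *)
Definition reduced (f : ternary) : Prop :=
  0 < cxx f /\ Z.abs (cxy f) <= cxx f /\ cxx f <= cyy f /\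
  0 < minor f /\ 3 * minor f ^ 2 <= 16 * cxx f * half_disc f.

(** With [a = cxx f], [4 a f] is a square plus [A y ^ 2 + 2 B y z + C z ^ 2], where [A = minor f]
    and [A C - B ^ 2 = 4 a half_disc f]. Once [B] is centered, [C < A] lets a swap of [y, z] lower
    [minor] at fixed [cxx]. Otherwise the bound on [A] holds; then [cxy] is centered, and if
    [cyy < cxx] a swap of [x, y] lowers [cxx]. The descent is lexicographic in [cxx] and [minor]. *)
Lemma ternary_reduction f : 0 < cxx f -> 0 < minor f -> 0 < half_disc f ->
  exists g, dominated f g /\ reduced g.
Proof.
suff main : forall n m f, (Z.to_nat (cxx f) < n)%nat -> (Z.to_nat (minor f) < m)%nat ->
    0 < cxx f -> 0 < minor f -> 0 < half_disc f -> exists g, dominated f g /\ reduced g.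
  exact: (main (S (Z.to_nat (cxx f))) (S (Z.to_nat (minor f)))); lia.
elim=> [|n IHn]; first by lia.
elim=> [|m IHm]; first by lia.
move=> {}f an mm a0 m0 h0.
have [k Hk] := @exists_centered_residue (minor f) (2 * cxx f * cyz f - cxz f * cxy f) m0.
have := dominated_shift_yz k f.
have Em : minor (shift_yz k f) = minor f by [].
have Ea : cxx (shift_yz k f) = cxx f by [].
have EB : 2 * cxx (shift_yz k f) * cyz (shift_yz k f) - cxz (shift_yz k f) * cxy (shift_yz k f)
   = 2 * cxx f * cyz f - cxz f * cxy f + minor f * k.
  by rewrite /minor /=; ring.
move: (shift_yz k f) Em Ea EB => g Em Ea EB dfg.
rewrite -EB in Hk.
set B := 2 * cxx g * cyz g - cxz g * cxy g in Hk EB.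
pose C := 4 * cxx g * czz g - cxz g ^ 2.
have hg : half_disc g = half_disc f by case: dfg.
have AC : minor g * C = 4 * cxx g * half_disc g + B ^ 2.
  by rewrite /minor /C /B /half_disc; ring.
have C0 : 0 < C by nia.
have [ltCA|leAC] := Z.lt_ge_cases C (minor g).
  have [|||||g' [d' r']] := IHm (swap_yz g).
  - by rewrite /= Ea.
  - by rewrite /minor /= -/C; lia.
  - by rewrite /= Ea.
  - by rewrite /minor /= -/C.
  - by case: (dominated_swap_yz g) => ->; rewrite hg.
  exists g'; split=> //.
  exact: dominated_trans dfg (dominated_trans (dominated_swap_yz g) d').
(* With [a = cxx g], [h = half_disc g] and [A = minor g]: [A ^ 2 <= A C = 4 a h + B ^ 2 <= 4 a h + A
   ^ 2 / 4]. *)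
have A2 : 3 * minor g ^ 2 <= 16 * cxx g * half_disc g.
  have MC : minor g * minor g <= minor g * C by apply: Z.mul_le_mono_nonneg_l; lia.
  have BM : Z.abs (2 * B) * Z.abs (2 * B) <= minor g * minor g.
    by apply: Z.mul_le_mono_nonneg; rewrite ?Em; lia.
  by move: BM; rewrite -Z.abs_mul Z.abs_eq; [lia|exact: Z.square_nonneg].
have [j Hj] := @exists_centered_residue (2 * cxx g) (cxy g) ltac:(lia).
have := dominated_shift_xy j g.
have Em' : minor (shift_xy j g) = minor g by rewrite /minor /=; ring.
have Ea' : cxx (shift_xy j g) = cxx g by [].
have Et' : cxy (shift_xy j g) = cxy g + 2 * cxx g * j by [].
move: (shift_xy j g) Em' Ea' Et' => g' Em' Ea' Et' dgg'.
have hg' : half_disc g' = half_disc g by case: dgg'.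
have b0 : 0 < cyy g'.
  apply (Z.mul_pos_cancel_l (cxx g')); first by rewrite Ea' Ea.
  have := Z.square_nonneg (cxy g'); move: Em'; rewrite {1}/minor Z.pow_2_r; lia.
have [ltba|leab] := Z.lt_ge_cases (cyy g') (cxx g').
  have [|||||g'' [d'' r'']] := IHn (S (Z.to_nat (minor g'))) (swap_xy g').
  - by rewrite /=; lia.
  - have -> : minor (swap_xy g') = minor g' by rewrite /minor /=; ring.
    lia.
  - by [].
  - have -> : minor (swap_xy g') = minor g' by rewrite /minor /=; ring.
    by rewrite Em' Em.
  - by case: (dominated_swap_xy g') => ->; rewrite hg' hg.
  exists g''; split=> //.
  exact: dominated_trans dfg (dominated_trans dgg' (dominated_trans (dominated_swap_xy g') d'')).
exists g'; split; first exact: dominated_trans dfg dgg'.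
split; [lia|split; [lia|split; [lia|split]]].
  by rewrite Em' Em.
by rewrite Em' Ea' hg'.
Qed.

(** With [a = cxx f], the minor is at least [3 a ^ 2], so Hermite's bound gives [27 a ^ 4 <= 64 a];
    hence [a = 1], and then [3 minor ^ 2 <= 64]. *)
Lemma reduced_leading f : reduced f -> half_disc f <= 4 -> cxx f = 1 /\ minor f <= 4.
Proof.
move=> [a0 [ta1 [ab [A0 A2]]]] h4.
have A3 : 3 * cxx f ^ 2 <= minor f by rewrite /minor; nia.
have A4 : 3 * minor f ^ 2 <= 64 * cxx f by nia.
have a1 : cxx f = 1.
  have [//|a2] : cxx f = 1 \/ 2 <= cxx f by lia.
  have A6 : 6 * cxx f <= minor f by nia.
  have : 12 * (6 * cxx f) <= minor f ^ 2 by rewrite Z.pow_2_r; apply: Z.mul_le_mono_nonneg; lia.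
  by lia.
by split=> //; rewrite a1 in A4; nia.
Qed.

(** Reduction leaves [x ^ 2 + y ^ 2] as binary part; the even cross terms with [z] are absorbed by
    translations, and the determinant fixes the coefficient 1 of [z ^ 2]. *)
Lemma dominated_half_disc4 f : 0 < cxx f -> 0 < minor f -> classical f -> half_disc f = 4 ->
  dominated f (Ternary 1 1 1 0 0 0).
Proof.
move=> a0 m0 cf h4; have [|g [dfg rg]] := ternary_reduction a0 m0; first by rewrite h4.
apply: (dominated_trans dfg).
have hg : half_disc g = 4 by case: dfg => ->.
have cg : classical g by case: dfg => _ [+ _]; apply.
have [|a1 m4] := reduced_leading rg; first by lia.
case: rg => _ [ta1 [_ [A0 _]]].
case: g cg hg a1 m4 ta1 A0 {dfg} => a b c r s t.
rewrite /half_disc /minor /classical /= => -[[r' ->] [[s' ->] [t' ->]]] hg a1 m4 ta1 A0.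
rewrite {}a1 in hg m4 ta1 A0 *; have t0 : t' = 0 by lia.
rewrite {}t0 in hg m4 A0 *; have b1 : b = 1 by lia.
rewrite {}b1 in hg m4 A0 *.
have c1 : c = 1 + r' ^ 2 + s' ^ 2 by lia.
rewrite c1; split; first by rewrite /half_disc /=; ring.
split; first by move=> _; split; [|split]; exists 0.
by move=> x y z; exists (x + s' * z), (y + r' * z), z; rewrite /teval /=; ring.
Qed.

(** The reduced binary part is [x ^ 2 + t x y + y ^ 2] with [t] among 0, 1, -1. For [t = 0] the
    determinant modulo 4 makes exactly one of [r], [s] odd; for [t = 1] or [t = -1], modulo 3, it
    makes [r + s] or [r - s] divisible by 3. Translations by multiples of [z] absorb the rest. *)
Lemma dominated_half_disc3 f : 0 < cxx f -> 0 < minor f -> half_disc f = 3 ->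
  forall x y z, exists x' y' z', teval f x y z = x' ^ 2 + (y' ^ 2 + y' * z' + z' ^ 2).
Proof.
move=> a0 m0 h3 x y z; have [|g [dfg rg]] := ternary_reduction a0 m0; first by rewrite h3.
have hg : half_disc g = 3 by case: dfg => ->.
have [x' [y' [z' <-]]] : exists x' y' z', teval g x' y' z' = teval f x y z.
  by case: dfg => _ [_ +]; apply.
have [|a1 m4] := reduced_leading rg; first by lia.
case: rg => _ [ta1 [_ [A0 _]]].
move: x' y' z' {x y z} => x y z.
case: g hg a1 m4 ta1 A0 {dfg} => a b c r s t.
rewrite /half_disc /minor /teval /= => hg a1 m4 ta1 A0.
rewrite {}a1 in hg m4 ta1 A0 *.
have b1 : b = 1 by nia.
rewrite {}b1 in hg m4 A0 *.
have rem n d : 0 < d -> exists k e, n = d * k + e /\ 0 <= e < d.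
  move=> d0; exists (n / d), (n mod d); split; first by apply: Z.div_mod; lia.
  exact: Z.mod_pos_bound.
have [t0|[t1|t1]] : t = 0 \/ t = 1 \/ t = -1 by lia.
- rewrite {}t0 {m4 A0 ta1} in hg *.
  have [k [e [Er re]]] := rem r 2 ltac:(lia); have [l [d [Es rd]]] := rem s 2 ltac:(lia).
  rewrite {}Er {}Es in hg *.
  have [e0|e1] : e = 0 \/ e = 1 by lia.
    have d1 : d = 1.
      have [d0|//] : d = 0 \/ d = 1 by lia.
      exfalso; rewrite d0 e0 in hg; lia.
    have {hg} -> : c = 1 + k ^ 2 + l ^ 2 + l by rewrite e0 d1 in hg; lia.
    by exists (y + k * z), (x + l * z), z; rewrite e0 d1; ring.
  have d0 : d = 0.
    have [//|d1] : d = 0 \/ d = 1 by lia.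
    exfalso; rewrite d1 e1 in hg; lia.
  have {hg} -> : c = 1 + k ^ 2 + l ^ 2 + k by rewrite e1 d0 in hg; lia.
  by exists (x + l * z), (y + k * z), z; rewrite e1 d0; ring.
- rewrite {}t1 {m4 A0 ta1} in hg *.
  have [m [e [E re]]] := rem (r + s) 3 ltac:(lia).
  have Er : r = 3 * m + e - s by lia.
  rewrite {}Er {E} in hg *.
  have e0 : e = 0.
    have [//|[e1|e2]] : e = 0 \/ e = 1 \/ e = 2 by lia.
    by exfalso; rewrite e1 in hg; lia.
  by exfalso; rewrite e2 in hg; lia.
  rewrite {}e0 {re} in hg *.
  have {hg} -> : c = 1 + (s - m) ^ 2 + (s - m) * (2 * m - s) + (2 * m - s) ^ 2 by lia.
  by exists z, (x + (s - m) * z), (y + (2 * m - s) * z); ring.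
rewrite {}t1 {m4 A0 ta1} in hg *.
have [m [e [E re]]] := rem (r - s) 3 ltac:(lia).
have Er : r = 3 * m + e + s by lia.
rewrite {}Er {E} in hg *.
have e0 : e = 0.
  have [//|[e1|e2]] : e = 0 \/ e = 1 \/ e = 2 by lia.
    by exfalso; rewrite e1 in hg; lia.
  by exfalso; rewrite e2 in hg; lia.
rewrite {}e0 {re} in hg *.
have {hg} -> : c = 1 + (s + m) ^ 2 - (s + m) * (s + 2 * m) + (s + 2 * m) ^ 2 by lia.
by exists z, (x + (s + m) * z), (- (y + (s + 2 * m) * z)); ring.
Qed.

(** * Ternary and quaternary representations *)

Lemma Zdivide_dvdn (d n : nat) : (d %| n)%N -> (Z.of_nat d | Z.of_nat n).
Proof. by move=> /dvdnP[k ->]; exists (Z.of_nat k); lia. Qed.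

Lemma dvdn_Zdivide (d n : nat) : (Z.of_nat d | Z.of_nat n) -> (d %| n)%N.
Proof.
move=> [k Hk]; apply/dvdnP; exists (Z.to_nat k).
by have [k0|k0] := Z.lt_ge_cases k 0; nia.
Qed.

Lemma Zgcd_coprime (m n : nat) : coprime m n -> Z.gcd (Z.of_nat m) (Z.of_nat n) = 1.
Proof.
move=> /eqP cmn; have g0 := Z.gcd_nonneg (Z.of_nat m) (Z.of_nat n).
have Eg : Z.of_nat (Z.to_nat (Z.gcd (Z.of_nat m) (Z.of_nat n))) = Z.gcd (Z.of_nat m) (Z.of_nat n) by lia.
have : (Z.to_nat (Z.gcd (Z.of_nat m) (Z.of_nat n)) %| gcdn m n)%N.
  rewrite dvdn_gcd; apply/andP; split; apply: dvdn_Zdivide; rewrite Eg.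
    exact: Z.gcd_divide_l.
  exact: Z.gcd_divide_r.
by rewrite cmn dvdn1 => /eqP; lia.
Qed.

(* With [D = n] or [D = 4 n], the three equations complete the square in a
   ternary form with leading coefficient [n]; what remains is the binary form
   [A y^2 + 2 B y z + C z^2]. *)
Lemma glue_binary_form (D A r B N : Z) : 0 < D -> 0 < A ->
    Z.gcd A D = 1 -> Z.gcd r D = 1 ->
    (D | A + r ^ 2) -> (A | B ^ 2 + N) -> (D | N) ->
  exists q al be ga C, [/\ D * al = A + r ^ 2, D * be = B + r * q,
    D * ga = C + q ^ 2 & A * C = B ^ 2 + N].
Proof.
move=> D0 A0 cA cr [al Eal] [C EC] [k Ek].
have [u [v Euv]] := Z.gcd_bezout r D 1 cr.
pose q := - (B * u).
(* As [u] inverts [r] modulo [D], this [q] solves [r q = -B] modulo [D], which makes [be]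
   integral. *)
have Erq : r * q = - B + D * (v * B).
  have Eur : u * r = 1 - v * D by lia.
  by transitivity (- B * (u * r)); [rewrite /q; ring|rewrite Eur; ring].
(* Modulo [D], [A = -r ^ 2] and [N = 0], so [A (C + q ^ 2)] is [B ^ 2 - (r q) ^ 2 = 0]; then [A] is
   cancelled, being prime to [D]. *)
have dC : (D | A * (C + q ^ 2)).
  have EA : A = D * al - r ^ 2 by lia.
  exists (k + al * q ^ 2 + 2 * B * (v * B) - D * (v * B) ^ 2).
  have -> : A * (C + q ^ 2) = C * A + (D * al - r ^ 2) * q ^ 2 by rewrite -EA; ring.
  have -> : (D * al - r ^ 2) * q ^ 2 = D * al * q ^ 2 - (r * q) ^ 2 by ring.
  by rewrite -EC Erq Ek; ring.
have [ga Ega] : (D | C + q ^ 2) by apply: Z.gauss dC _; rewrite Z.gcd_comm.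
exists q, al, (v * B), ga, C; split; [lia|rewrite Erq; ring|lia|lia].
Qed.

Lemma neg_square_norm_Z (D M N : nat) : (0 < D)%N -> (D %| M)%N -> neg_square_norm D M N ->
  exists A r B : Z, [/\ 0 < A, Z.gcd A (Z.of_nat D) = 1, Z.gcd r (Z.of_nat D) = 1,
    (Z.of_nat D | A + r ^ 2) & (A | B ^ 2 + Z.of_nat N)].
Proof.
move=> D0 dDM [A [r [B [A0 cA cr dr dB]]]].
exists (Z.of_nat A), (Z.of_nat r), (Z.of_nat B); split; first by lia.
- by apply/Zgcd_coprime/(coprime_dvdr dDM).
- by apply/Zgcd_coprime/(coprime_dvdr dDM).
- have -> : Z.of_nat A + Z.of_nat r ^ 2 = Z.of_nat (A + r ^ 2)%N by rewrite -mulnn; lia.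
  exact: Zdivide_dvdn.
- have -> : Z.of_nat B ^ 2 + Z.of_nat N = Z.of_nat (B ^ 2 + N)%N by rewrite -mulnn; lia.
  exact: Zdivide_dvdn.
Qed.

(** The glued form satisfies [m f = (m x + r y + q z) ^ 2 + A y ^ 2 + 2 B y z + C z ^ 2] with
    [A C - B ^ 2 = m], so its [half_disc] is 4, and it takes the value [m] at [(1, 0, 0)]. *)
Theorem sum_three_squares (m : Z) : 0 < m -> m mod 4 = 1 \/ m mod 4 = 2 ->
  exists x y z, m = x ^ 2 + y ^ 2 + z ^ 2.
Proof.
move=> m0 m4; pose n := Z.to_nat m; have En : Z.of_nat n = m by lia.
have [A [r [B []]]] : exists A r B : Z, [/\ 0 < A, Z.gcd A (Z.of_nat n) = 1,
    Z.gcd r (Z.of_nat n) = 1, (Z.of_nat n | A + r ^ 2) & (A | B ^ 2 + Z.of_nat n)].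
  apply: (@neg_square_norm_Z n (8 * n) n); [lia|exact: dvdn_mull|].
  have := divn_eq n 4; have : (n %% 4 < 4)%N by rewrite ltn_mod.
  have := Z.div_mod m 4 ltac:(lia); move: (m / 4) (n %/ 4)%N => u v.
  by case: m4 => -> *; [apply: neg_square_norm_mod4|apply: neg_square_norm_mod2]; lia.
rewrite En => A0 cA cr dr dB.
have [q [al [be [ga [C [Eal Ebe Ega EC]]]]]] :=
  glue_binary_form m0 A0 cA cr dr dB (Z.divide_refl m).
pose f := Ternary m al ga (2 * be) (2 * q) (2 * r).
have [x [y [z Exyz]]] : exists x y z, teval (Ternary 1 1 1 0 0 0) x y z = teval f 1 0 0.
  suff: dominated f (Ternary 1 1 1 0 0 0) by case=> _ [_ +]; apply.
  apply: dominated_half_disc4 => //.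
  - rewrite /minor /=; have -> : 4 * m * al - (2 * r) ^ 2 = 4 * (m * al - r ^ 2) by ring.
    by rewrite Eal; lia.
  - by split; [exists be|split; [exists q|exists r]].
  apply: (Z.mul_reg_l _ _ m); first by lia.
  rewrite /half_disc /=.
  transitivity (4 * ((m * al - r ^ 2) * (m * ga - q ^ 2) - (m * be - r * q) ^ 2)); first by ring.
  rewrite Eal Ega Ebe; transitivity (4 * (A * C - B ^ 2)); first by ring.
  by rewrite EC; ring.
by exists x, y, z; move: Exyz; rewrite /teval /=; lia.
Qed.

Theorem square_plus_hexagonal (n : Z) : 0 < n -> n mod 3 <> 0 ->
  exists x z w, n = x ^ 2 + (z ^ 2 + z * w + w ^ 2).
Proof.
move=> n0 n3; pose k := Z.to_nat n; have Ek : Z.of_nat k = n by lia.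
have [A [r [B []]]] : exists A r B : Z, [/\ 0 < A, Z.gcd A (Z.of_nat (4 * k)) = 1,
    Z.gcd r (Z.of_nat (4 * k)) = 1, (Z.of_nat (4 * k) | A + r ^ 2)
    & (A | B ^ 2 + Z.of_nat (3 * k))].
  apply: (@neg_square_norm_Z (4 * k) (8 * (3 * k)) (3 * k)); [lia| |].
    have -> : (8 * (3 * k) = 6 * (4 * k))%N by rewrite !mulnA.
    exact: dvdn_mull (dvdnn _).
  apply: neg_square_norm_3n; first by lia.
  rewrite coprime_sym prime_coprime //; apply/negP => /dvdnP[j Ej]; apply: n3.
  have -> : n = Z.of_nat j * 3 by lia.
  exact: Z.mod_mul.
have -> : Z.of_nat (4 * k) = 4 * n by lia.
have -> : Z.of_nat (3 * k) = 3 * n by lia.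
move=> A0 cA cr dr [C0 EC0].
(* Doubling [B] replaces [3 n] by [12 n], a multiple of [D = 4 n]; then [4 n f] is a square plus a
   binary form of determinant [12 n], whence [half_disc f = 3]. *)
have dB : (A | (2 * B) ^ 2 + 12 * n) by exists (4 * C0); lia.
have dn : (4 * n | 12 * n) by exists 3; ring.
have n4 : 0 < 4 * n by lia.
have [q [al [be [ga [C [Eal Ebe Ega EC]]]]]] := glue_binary_form n4 A0 cA cr dr dB dn.

pose f := Ternary n al ga (2 * be) q r.
have m0 : 0 < minor f by rewrite /minor /=; lia.
have h3 : half_disc f = 3.
  apply: (Z.mul_reg_l _ _ (4 * n)); first by lia.
  rewrite /half_disc /=.
  transitivity ((4 * n * al - r ^ 2) * (4 * n * ga - q ^ 2) - (4 * n * be - r * q) ^ 2).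
    by ring.
  rewrite Eal Ega Ebe; transitivity (A * C - (2 * B) ^ 2); first by ring.
  by rewrite EC; ring.
have [x [z [w E]]] := @dominated_half_disc3 f n0 m0 h3 1 0 0.
by exists x, z, w; rewrite -E /teval /=; ring.
Qed.

(** * The norm form of the Eisenstein integers *)

Definition hex (z w : Z) : Z := z ^ 2 + z * w + w ^ 2.

Lemma hex_mul2 z w : hex (2 * z) (2 * w) = 4 * hex z w.
Proof. by rewrite /hex; ring. Qed.

(** Multiplication by an Eisenstein integer of norm 3. *)
Lemma hex_mul3 z w : hex (z - w) (z + 2 * w) = 3 * hex z w.
Proof. by rewrite /hex; ring. Qed.

(** The prime 2 is inert in the Eisenstein integers. *)
Lemma hex_even z w : Z.Even (hex z w) -> exists z' w', z = 2 * z' /\ w = 2 * w'.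
Proof.
rewrite /hex => -[k Ek].
have rem n : exists k e, n = 2 * k + e /\ (e = 0 \/ e = 1).
  exists (n / 2), (n mod 2); split; first by apply: Z.div_mod; lia.
  by have := Z.mod_pos_bound n 2; lia.
have [z' [d [Ez rd]]] := rem z; have [w' [e [Ew re]]] := rem w.
exists z', w'; rewrite Ez Ew in Ek *.
by case: rd re Ek => -> [] ->; lia.
Qed.

Lemma mod3_cases n : exists k, [\/ n = 3 * k, n = 3 * k + 1 | n = 3 * k - 1].
Proof.
have := Z.div_mod n 3; have := Z.mod_pos_bound n 3.
set q := n / 3; set r := n mod 3 => rb E.
have [r0|[r1|r2]] : r = 0 \/ r = 1 \/ r = 2 by lia.
- by exists q; constructor 1; lia.
- by exists q; constructor 2; lia.
- by exists (q + 1); constructor 3; lia.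
Qed.

(** Three squares whose sum is divisible by 3 have, up to signs, [a = b = c] modulo 3. The identity
    behind is [3 (a ^ 2 + b ^ 2 + c ^ 2) = (a + b + c) ^ 2 + 2 hex (a - b) (b - c)], with
    [a + b + c = 6 u]. *)
Lemma three_squares_mod3 n a b c : a ^ 2 + b ^ 2 + c ^ 2 = 6 * n ->
  exists x z w, n = 2 * x ^ 2 + hex z w.
Proof.
have unsign y : exists y' k e, [/\ y ^ 2 = y' ^ 2, y' = 3 * k + e & e = 0 \/ e = 1].
  have [k [] Ek] := mod3_cases y.
  - by exists y, k, 0; split; [|lia|left].
  - by exists y, k, 1; split; [|lia|right].
  - by exists (- y), (- k), 1; split; [ring|lia|right].
have [a' [i [e [-> Ea re]]]] := unsign a; have [b' [j [e1 [-> Eb re1]]]] := unsign b.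
have [c' [k [e2 [-> Ec re2]]]] := unsign c.
rewrite {}Ea {}Eb {}Ec => {a b c a' b' c' unsign} E.
have [E1 E2] : e1 = e /\ e2 = e.
  by case: re E => ->; case: re1 => ->; case: re2 => -> E; split; lia.
rewrite {}E1 {}E2 {re1 re2} in E.
have [u Eu] : Z.Even (i + j + k + e).
  have [//|[u Eu]] := Z.Even_or_Odd (i + j + k + e); exfalso.
  have Ek : k = 2 * u + 1 - i - j - e by lia.
  by rewrite {}Ek {Eu} in E; case: re E => ->; lia.
exists u, (i - j), (j - k); rewrite /hex.
have Ek : k = 2 * u - i - j - e by lia.
by rewrite {}Ek {Eu} in E *; case: re E => ->; lia.
Qed.

Lemma two_square_plus_hex_odd n : 0 < n -> Z.Odd n -> exists x z w, n = 2 * x ^ 2 + hex z w.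
Proof.
move=> n0 [k Ek]; have [||a [b [c E]]] := @sum_three_squares (6 * n); first by lia.
  right; rewrite Ek; have -> : 6 * (2 * k + 1) = 2 + (3 * k + 1) * 4 by ring.
  by rewrite Z.mod_add.
exact: three_squares_mod3 (esym E).
Qed.

Lemma two_square_plus_hex_6mod8 k : 0 <= k ->
  exists x z w, 8 * k + 6 = 2 * x ^ 2 + hex z w.
Proof.
(* Six times [8 k + 6] is [4 (12 k + 9)], so a representation of [12 k + 9] is doubled. *)
move=> k0; have [||a [b [c E]]] := @sum_three_squares (12 * k + 9); first by lia.
  by left; have -> : 12 * k + 9 = 1 + (3 * k + 2) * 4 by [ring]; rewrite Z.mod_add.
by apply: (@three_squares_mod3 _ (2 * a) (2 * b) (2 * c)); lia.
Qed.

Lemma two_square_plus_hex_4 n : (exists x z w, n = 2 * x ^ 2 + hex z w) ->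
  exists x z w, 4 * n = 2 * x ^ 2 + hex z w.
Proof.
by move=> [x [z [w ->]]]; exists (2 * x), (2 * z), (2 * w); rewrite /hex; ring.
Qed.

(** * Sufficiency: the fifteen forms are universal *)

Lemma representsE a b n x y z w : n = a * x ^ 2 + b * y ^ 2 + hex z w -> represents a b n.
Proof. by move=> ->; exists x, y, z, w. Qed.

Lemma represents0 a b : represents a b 0.
Proof. by apply: (@representsE _ _ _ 0 0 0 0); rewrite /hex; ring. Qed.

Lemma represents_mul4 a b n : represents a b n -> represents a b (4 * n).
Proof.
move=> [x [y [z [w <-]]]]; apply: (@representsE _ _ _ (2 * x) (2 * y) (2 * z) (2 * w)).
by rewrite /f1 /hex; ring.
Qed.

Lemma represents_hex1 b n y : 0 < n - b * y ^ 2 -> (n - b * y ^ 2) mod 3 <> 0 ->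
  represents 1 b n.
Proof.
move=> h0 h3; have [x [z [w E]]] := square_plus_hexagonal h0 h3.
by apply: (@representsE _ _ _ x y z w); rewrite /hex; lia.
Qed.

Lemma represents_hex2 b n y : (exists x z w, n - b * y ^ 2 = 2 * x ^ 2 + hex z w) ->
  represents 2 b n.
Proof. by move=> [x [z [w E]]]; apply: (@representsE _ _ _ x y z w); lia. Qed.

Lemma strong_induction_Z (P : Z -> Prop) :
  (forall n, 0 <= n -> (forall m, 0 <= m < n -> P m) -> P n) -> forall n, 0 <= n -> P n.
Proof. by move=> H n; apply: (Zlt_0_ind P) => {}n IH n0; apply: H. Qed.

(** One of [n] and [n - b] is odd; the even [n < b] are written down by hand. *)
Lemma universal2_odd b : b = 3 \/ b = 5 \/ b = 7 \/ b = 9 -> universal 2 b.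
Proof.
move=> hb n n0; have [[k Ek]|n_odd] := Z.Even_or_Odd n; last first.
  apply: (@represents_hex2 _ _ 0).
  have -> : n - b * 0 ^ 2 = n by ring.
  by apply: two_square_plus_hex_odd => //; case: n_odd; lia.
have [ltnb|lebn] := Z.lt_ge_cases n b.
  have : n = 0 \/ n = 2 \/ n = 4 \/ n = 6 \/ n = 8 by lia.
  case=> [->|[->|[->|[->|->]]]]; first exact: represents0.
  - by apply: (@representsE _ _ _ 1 0 0 0); rewrite /hex; lia.
  - by apply: (@representsE _ _ _ 0 0 2 0); rewrite /hex; lia.
  - by apply: (@representsE _ _ _ 1 0 2 0); rewrite /hex; lia.
  - by apply: (@representsE _ _ _ 2 0 0 0); rewrite /hex; lia.
apply: (@represents_hex2 _ _ 1).
have -> : n - b * 1 ^ 2 = n - b by ring.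
have o : Z.Odd (n - b).
  by case: hb => [->|[->|[->|->]]]; [exists (k - 2)|exists (k - 3)|exists (k - 4)|exists (k - 5)]; lia.
by apply: two_square_plus_hex_odd => //; case: o; lia.
Qed.

(** Odd [n] and [n = 6] modulo 8 are reached with [y = 0], and multiples of 4 descend to [n / 4], so
    only the class 2 modulo 8 depends on [b]. *)
Lemma universal_step4 b : (forall k, 0 <= k -> represents 2 b (8 * k + 2)) -> universal 2 b.
Proof.
move=> H; apply: strong_induction_Z => n n0 IH.
have := Z.div_mod n 8; have := Z.mod_pos_bound n 8.
set k := n / 8; set r := n mod 8 => rb E.
have [n_odd|[r4|[r2|r6]]] : Z.Odd n \/ (r = 0 \/ r = 4) \/ r = 2 \/ r = 6.
  have [[j Ej]|] := Z.Even_or_Odd n; last by left.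
  by right; lia.
- apply: (@represents_hex2 _ _ 0).
  have -> : n - b * 0 ^ 2 = n by ring.
  by apply: two_square_plus_hex_odd => //; case: n_odd; lia.
- have [->|n1] : n = 0 \/ 0 < n by lia.
    exact: represents0.
  have [j Ej] : exists j, n = 4 * j by case: r4 => e; [exists (2 * k)|exists (2 * k + 1)]; lia.
  by rewrite Ej; apply/represents_mul4/IH; lia.
- have -> : n = 8 * k + 2 by lia.
  by apply: H; lia.
apply: (@represents_hex2 _ _ 0).
have -> : n - b * 0 ^ 2 = 8 * k + 6 by lia.
by apply: two_square_plus_hex_6mod8; lia.
Qed.

Lemma two_square_plus_hex_4odd k : 0 < k -> Z.Odd k ->
  exists x z w, 4 * k = 2 * x ^ 2 + hex z w.
Proof. by move=> k0 ko; apply/two_square_plus_hex_4/two_square_plus_hex_odd. Qed.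

Lemma two_square_plus_hex_16odd k : 0 < k -> Z.Odd k ->
  exists x z w, 16 * k = 2 * x ^ 2 + hex z w.
Proof.
move=> k0 ko; have -> : 16 * k = 4 * (4 * k) by ring.
by apply/two_square_plus_hex_4/two_square_plus_hex_4odd.
Qed.

Lemma two_square_plus_hex_24mod32 k : 0 <= k ->
  exists x z w, 32 * k + 24 = 2 * x ^ 2 + hex z w.
Proof.
move=> k0; have -> : 32 * k + 24 = 4 * (8 * k + 6) by ring.
by apply/two_square_plus_hex_4/two_square_plus_hex_6mod8.
Qed.

(** The choices [y = 1] and [y = 3] leave [8 k] and [8 k - 16]: one of them is 16 times an odd
    number if [k] is even, and 24 modulo 32 if [k] is odd. *)
Lemma represents22 k : 0 <= k -> represents 2 2 (8 * k + 2).
Proof.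
move=> k0; have [[j Ej]|[j Ej]] := Z.Even_or_Odd k; subst k.
  have [j0|j0] : j = 0 \/ 0 < j by lia.
    by rewrite j0; apply: (@representsE _ _ _ 1 0 0 0); rewrite /hex; lia.
  have [[i Ei]|jo] := Z.Even_or_Odd j.
    apply: (@represents_hex2 _ _ 3).
    have -> : 8 * (2 * j) + 2 - 2 * 3 ^ 2 = 16 * (j - 1) by lia.
    by apply: two_square_plus_hex_16odd; [lia|exists (i - 1); lia].
  apply: (@represents_hex2 _ _ 1).
  have -> : 8 * (2 * j) + 2 - 2 * 1 ^ 2 = 16 * j by lia.
  exact: two_square_plus_hex_16odd.
have [[i Ei]|[i Ei]] := Z.Even_or_Odd j; subst j.
  have [i0|i0] : i = 0 \/ 0 < i by lia.
    by rewrite i0; apply: (@representsE _ _ _ 2 1 0 0); rewrite /hex; lia.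
  apply: (@represents_hex2 _ _ 3).
  have -> : 8 * (2 * (2 * i) + 1) + 2 - 2 * 3 ^ 2 = 32 * (i - 1) + 24 by lia.
  by apply: two_square_plus_hex_24mod32; lia.
apply: (@represents_hex2 _ _ 1).
have -> : 8 * (2 * (2 * i + 1) + 1) + 2 - 2 * 1 ^ 2 = 32 * i + 24 by lia.
by apply: two_square_plus_hex_24mod32; lia.
Qed.

Lemma represents24 k : 0 <= k -> represents 2 4 (8 * k + 2).
Proof.
move=> k0; have [->|k1] : k = 0 \/ 0 < k by lia.
  by apply: (@representsE _ _ _ 1 0 0 0); rewrite /hex; lia.
apply: (@represents_hex2 _ _ 1).
have -> : 8 * k + 2 - 4 * 1 ^ 2 = 8 * (k - 1) + 6 by lia.
by apply: two_square_plus_hex_6mod8; lia.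
Qed.

Lemma represents26 k : 0 <= k -> represents 2 6 (8 * k + 2).
Proof.
move=> k0; have [->|k1] : k = 0 \/ 0 < k by lia.
  by apply: (@representsE _ _ _ 1 0 0 0); rewrite /hex; lia.
apply: (@represents_hex2 _ _ 1).
have -> : 8 * k + 2 - 6 * 1 ^ 2 = 4 * (2 * k - 1) by lia.
by apply: two_square_plus_hex_4odd; [lia|exists (k - 1); lia].
Qed.

(** Start from [2 x ^ 2 + 2 y ^ 2 + hex z w = 8 k + 2]: the norm is even, hence divisible by 4, so
    [x ^ 2 + y ^ 2] is odd and one of [x], [y] is even. *)
Lemma represents28 k : 0 <= k -> represents 2 8 (8 * k + 2).
Proof.
move=> /represents22[x [y [z [w]]]]; rewrite /f1 -/(hex z w) => E.
have [|z' [w' [Ez Ew]]] := @hex_even z w; first by exists (4 * k + 1 - x ^ 2 - y ^ 2); lia.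
have {}E : x ^ 2 + y ^ 2 = 4 * k + 1 - 2 * hex z' w'.
  by move: E; rewrite Ez Ew hex_mul2; lia.
have sq2 u : (2 * u) ^ 2 = 4 * u ^ 2 by ring.
have [[y' Ey]|[y' Ey]] := Z.Even_or_Odd y.
  by apply: (@representsE _ _ _ x y' (2 * z') (2 * w')); move: E; rewrite Ey sq2 hex_mul2; lia.
have [[x' Ex]|[x' Ex]] := Z.Even_or_Odd x.
  by apply: (@representsE _ _ _ y x' (2 * z') (2 * w')); move: E; rewrite Ex sq2 hex_mul2; lia.
have sq1 u : (2 * u + 1) ^ 2 = 4 * (u ^ 2 + u) + 1 by ring.
by exfalso; move: E; rewrite Ex Ey !sq1; lia.
Qed.

(** Again [y = 1] or [y = 3]: the remainders [8 k - 8] and [8 k - 88] differ by 16 modulo 32. The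
    explicit cases are those where the chosen remainder is negative. *)
Lemma represents2_10 k : 0 <= k -> represents 2 10 (8 * k + 2).
Proof.
move=> k0; have [[j Ej]|[j Ej]] := Z.Even_or_Odd k; subst k; last first.
  have [->|[->|[->|j1]]] : j = 0 \/ j = 2 \/ j = 4 \/ (0 < j /\ j <> 2 /\ j <> 4) by lia.
  - by apply: (@representsE _ _ _ 0 1 0 0); rewrite /hex; lia.
  - by apply: (@representsE _ _ _ 4 1 0 0); rewrite /hex; lia.
  - by apply: (@representsE _ _ _ 0 1 8 0); rewrite /hex; lia.
  have [[i Ei]|jo] := Z.Even_or_Odd j.
    apply: (@represents_hex2 _ _ 3).
    have -> : 8 * (2 * j + 1) + 2 - 10 * 3 ^ 2 = 16 * (j - 5) by lia.
    by apply: two_square_plus_hex_16odd; [lia|exists (i - 3); lia].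
  apply: (@represents_hex2 _ _ 1).
  have -> : 8 * (2 * j + 1) + 2 - 10 * 1 ^ 2 = 16 * j by lia.
  by apply: two_square_plus_hex_16odd => //; lia.
have [[i Ei]|[i Ei]] := Z.Even_or_Odd j; subst j.
  have [->|i0] : i = 0 \/ 0 < i by lia.
    by apply: (@representsE _ _ _ 1 0 0 0); rewrite /hex; lia.
  apply: (@represents_hex2 _ _ 1).
  have -> : 8 * (2 * (2 * i)) + 2 - 10 * 1 ^ 2 = 32 * (i - 1) + 24 by lia.
  by apply: two_square_plus_hex_24mod32; lia.
have [->|[->|[->|i1]]] : i = 0 \/ i = 1 \/ i = 2 \/ 3 <= i by lia.
- by apply: (@representsE _ _ _ 3 0 0 0); rewrite /hex; lia.
- by apply: (@representsE _ _ _ 5 0 0 0); rewrite /hex; lia.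
- by apply: (@representsE _ _ _ 6 1 0 0); rewrite /hex; lia.
apply: (@represents_hex2 _ _ 3).
have -> : 8 * (2 * (2 * i + 1)) + 2 - 10 * 3 ^ 2 = 32 * (i - 3) + 24 by lia.
by apply: two_square_plus_hex_24mod32; lia.
Qed.

Lemma universal2 b : 2 <= b <= 10 -> universal 2 b.
Proof.
move=> hb.
have : b = 2 \/ b = 4 \/ b = 6 \/ b = 8 \/ b = 10 \/ (b = 3 \/ b = 5 \/ b = 7 \/ b = 9).
  by lia.
case=> [->|[->|[->|[->|[->|]]]]]; last exact: universal2_odd.
- exact: universal_step4 represents22.
- exact: universal_step4 represents24.
- exact: universal_step4 represents26.
- exact: universal_step4 represents28.
exact: universal_step4 represents2_10.
Qed.

Lemma universal1_step b :
  0 < b -> (forall k, 0 <= k -> (forall m, 0 <= m < 3 * k -> represents 1 b m) ->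
     represents 1 b (3 * k)) -> universal 1 b.
Proof.
move=> b0 H; apply: strong_induction_Z => n n0 IH.
have [k Ek] := mod3_cases n.
have [E|nE] : n = 3 * k \/ n <> 3 * k by lia.
  by rewrite E; apply: H; rewrite -?E //; lia.
apply: (@represents_hex1 _ _ 0); first by case: Ek; lia.
have -> : n - b * 0 ^ 2 = n by ring.
move=> /Z.mod_divide[|j Ej]; first by [].
by case: Ek; lia.
Qed.

(** As 3 does not divide [b], it does not divide [3 k - b], so [y = 1] serves. *)
Lemma universal1_coprime b : b = 1 \/ b = 2 \/ b = 4 \/ b = 5 -> universal 1 b.
Proof.
move=> hb; apply: universal1_step; first by lia.
move=> k k0 _; have [->|[->|[k2 k3]]] : k = 0 \/ k = 1 \/ (1 < k /\ b < 3 * k) by lia.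
- exact: represents0.
- by apply: (@representsE _ _ _ 0 0 1 1); rewrite /hex; lia.
apply: (@represents_hex1 _ _ 1); first by lia.
by move=> /Z.mod_divide[|j Ej] //; lia.
Qed.

Lemma universal1 b : 1 <= b <= 6 -> universal 1 b.
Proof.
move=> hb; have : b = 3 \/ b = 6 \/ (b = 1 \/ b = 2 \/ b = 4 \/ b = 5) by lia.
case=> [->|[->|]]; last exact: universal1_coprime.
- apply: universal1_step => // k k0 IH.
  have [->|k1] : k = 0 \/ 0 < k by lia.
    exact: represents0.
  have [|x [y [z [w E]]]] := IH k; first by lia.
  (* Tripling a representation of [k] exchanges the roles of the squares:
     [3 k = (3 y) ^ 2 + 3 x ^ 2 + 3 hex z w]. *)
  apply: (@representsE _ _ _ (3 * y) x (z - w) (z + 2 * w)).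
  by rewrite hex_mul3 -E /f1 /hex; ring.
apply: universal1_step => // k k0 _.
(* The same tripling carries [2 x ^ 2 + 3 y ^ 2 + hex z w] to the form with [b = 6]. *)
have [x [y [z [w E]]]] := @universal2 3 ltac:(lia) k k0.
apply: (@representsE _ _ _ (3 * y) x (z - w) (z + 2 * w)).
by rewrite hex_mul3 -E /f1 /hex; ring.
Qed.

(** * Necessity: the values 2, 6 and 10 *)

Lemma hex_ge0 z w : 0 <= hex z w.
Proof. by rewrite /hex; have := Z.square_nonneg (2 * z + w); have := Z.square_nonneg w; lia. Qed.

Lemma hex_neq_double_odd z w k : hex z w <> 2 * (2 * k + 1).
Proof.
move=> E; have [|z' [w' [Ez Ew]]] := @hex_even z w; first by exists (2 * k + 1).
by move: E; rewrite Ez Ew /hex; lia.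
Qed.

(** Modulo 3, [hex z w] is [(z - w) ^ 2]. *)
Lemma hex_neq_2mod3 z w k : hex z w <> 3 * k - 1.
Proof.
rewrite /hex => E; have [j Ej] := mod3_cases (z - w).
have [e [Ez re]] : exists e, z = w + 3 * j + e /\ (e = 0 \/ e = 1 \/ e = -1).
  by exists (z - w - 3 * j); case: Ej; lia.
by rewrite Ez in E; case: re E => [|[]] ->; lia.
Qed.

Lemma small_square c x n : 0 <= n -> n < c -> c * x ^ 2 <= n -> x = 0.
Proof.
move=> n0 nc cx; have [//|x0] := Z.eq_dec x 0.
have x1 : 1 <= x ^ 2 by rewrite Z.pow_2_r; nia.
by have := Z.mul_le_mono_nonneg_l _ _ c ltac:(lia) x1; lia.
Qed.

(** If [a >= 3], then [x] and [y] vanish and 2 would be a norm. *)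
Lemma represents2_bound a b : 0 < a -> a <= b -> represents a b 2 -> a <= 2.
Proof.
move=> a0 ab [x [y [z [w]]]]; rewrite /f1 -/(hex z w) => E.
have [//|a3] := Z.le_gt_cases a 2; exfalso; have h0 := @hex_ge0 z w.
have x0 : x = 0 by apply: (@small_square a x 2); nia.
have y0 : y = 0 by apply: (@small_square b y 2); nia.
by apply: (@hex_neq_double_odd z w 0); rewrite x0 y0 in E; lia.
Qed.

(** If [b >= 7], then [y = 0] and the norm [6 - x ^ 2] would be 6, 5 or 2. *)
Lemma represents6_bound b : represents 1 b 6 -> b <= 6.
Proof.
move=> [x [y [z [w]]]]; rewrite /f1 -/(hex z w) => E.
have [//|b7] := Z.le_gt_cases b 6; exfalso; have h0 := @hex_ge0 z w.
have y0 : y = 0 by apply: (@small_square b y 6); nia.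
have : x = 0 \/ (x = 1 \/ x = -1) \/ (x = 2 \/ x = -2) by nia.
case=> [x0|[x1|x2]].
- by apply: (@hex_neq_double_odd z w 1); rewrite x0 y0 in E; lia.
- by apply: (@hex_neq_2mod3 z w 2); case: x1 => x1; rewrite x1 y0 in E; lia.
by apply: (@hex_neq_2mod3 z w 1); case: x2 => x2; rewrite x2 y0 in E; lia.
Qed.

(** If [b >= 11], then [y = 0] and the norm [10 - 2 x ^ 2] would be 10, 8 or 2. *)
Lemma represents10_bound b : represents 2 b 10 -> b <= 10.
Proof.
move=> [x [y [z [w]]]]; rewrite /f1 -/(hex z w) => E.
have [//|b7] := Z.le_gt_cases b 10; exfalso; have h0 := @hex_ge0 z w.
have y0 : y = 0 by apply: (@small_square b y 10); nia.
have : x = 0 \/ (x = 1 \/ x = -1) \/ (x = 2 \/ x = -2) by nia.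
case=> [x0|[x1|x2]].
- by apply: (@hex_neq_double_odd z w 2); rewrite x0 y0 in E; lia.
- by apply: (@hex_neq_2mod3 z w 3); case: x1 => x1; rewrite x1 y0 in E; lia.
by apply: (@hex_neq_double_odd z w 0); case: x2 => x2; rewrite x2 y0 in E; lia.
Qed.

Theorem theorem3p8 (a b : Z) (ha : 0 < a) (hab : a <= b) :
  (universal a b <->
     (a = 1 /\ 1 <= b <= 6) \/ (a = 2 /\ 2 <= b <= 10))
  /\
  (represents a b 1 -> represents a b 2 -> represents a b 6 ->
   represents a b 10 -> universal a b).
Proof.
have crit : represents a b 2 -> represents a b 6 -> represents a b 10 ->
    (a = 1 /\ 1 <= b <= 6) \/ (a = 2 /\ 2 <= b <= 10).
  move=> /(represents2_bound ha hab) a2.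
  have [Ea|Ea] : a = 1 \/ a = 2 by lia.
    by rewrite Ea => /represents6_bound b6 _; left; lia.
  by rewrite Ea => _ /represents10_bound b10; right; lia.
have univ : (a = 1 /\ 1 <= b <= 6) \/ (a = 2 /\ 2 <= b <= 10) -> universal a b.
  by case=> -[-> hb]; [exact: universal1|exact: universal2].
split; last by move=> _ r2 r6 r10; apply/univ/crit.
by split=> // u; apply: crit; apply: u; lia.
Qed.
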